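(* Let $N\ge 1$ and $m\ge 2$ be integers, let $r\ge 1$ and $p=2r+1$. Assume that either $N\le 3$, or $N=4$ and $p<15/4$. Let $B=(\beta_{ij})$ be a real symmetric $m\times m$ matrix such that $\beta_{ij}\ge 0$ for all $i\neq j$ and $\beta_{ii}>0$ for all $i$. Then the problem $$\begin{cases}\dfrac{\partial u_i}{\partial t}-\Delta u_i=\displaystyle\sum_{j=1}^m\beta_{ij}\,u_i^{r}u_j^{r+1}, & x\in\mathbb{R}^N_+,\ t\in\mathbb{R},\ i=1,\dots,m,\\[2mm] u_i=0, & x\in\partial\mathbb{R}^N_+,\ t\in\mathbb{R},\ i=1,\dots,m,\end{cases}$$ has no nontrivial, nonnegative, bounded classical solution $U=(u_1,\dots,u_m)$.
   Context: $\mathbb{R}^N_+=\{x=(x_1,\dots,x_N)\in\mathbb{R}^N: x_1>0\}$, and $\Delta$ is the Laplacian in $x$. A classical solution has components $u_i$ of class $C^{2,1}$ (that is, $C^2$ in $x$ and $C^1$ in $t$) in $\mathbb{R}^N_+\times\mathbb{R}$, continuous up to $\partial\mathbb{R}^N_+\times\mathbb{R}$, satisfying the equations and the boundary conditions pointwise. Nonnegative means $u_i\ge 0$ for every $i$; nontrivial means that $U$ is not identically $(0,\dots,0)$ (some components may vanish identically). *)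

(* Defs.v *)
From HB Require Import structures.
From mathcomp Require Import all_boot all_order all_algebra.
From mathcomp Require Import all_classical all_reals all_analysis.
Import Order.TTheory GRing.Theory Num.Theory.
Import numFieldNormedType.Exports.

Set Implicit Arguments.
Unset Strict Implicit.
Unset Printing Implicit Defensive.

Local Open Scope classical_set_scope.
Local Open Scope ring_scope.

Section HalfSpace.
Context {R : realType} {N : nat} (hN : (1 <= N)%N).

(* The coordinate written x_1 in the mathematics is the one of index 0. *)
Definition half_space : set 'rV[R]_N := [set x | 0 < x 0 (Ordinal hN)].

Definition half_space_bd : set 'rV[R]_N := [set x | x 0 (Ordinal hN) = 0].

Definition half_space_cl : set 'rV[R]_N := half_space `|` half_space_bd.

End HalfSpace.

Section Parabolic.
Context {R : realType} {N : nat}.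
Implicit Types (u : 'rV[R]_N -> R -> R) (x : 'rV[R]_N) (t : R).

Definition dx (i : 'I_N) u x t : R := 'D_(delta_mx 0 i) (fun y => u y t) x.

Definition dt u x t : R := 'D_1 (u x) t.

Definition laplacian u x t : R := \sum_(i < N) dx i (dx i u) x t.

(* Class C^{2,1} on A x R, for A open: u, its spatial derivatives of order at
   most two and its time derivative exist on A x R and are jointly continuous
   in (x, t).  Since 'D is a total operator, existence is required separately
   by derivable. *)
Record C21 (A : set 'rV[R]_N) u : Prop := {
  C21_cont : {within A `*` setT, continuous (uncurry u)};
  C21_ex_dx : forall i x t, A x ->
    derivable (fun y => u y t) x (delta_mx 0 i);
  C21_dx : forall i, {within A `*` setT, continuous (uncurry (dx i u))};
  C21_ex_dxx : forall i j x t, A x ->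
    derivable (fun y => dx i u y t) x (delta_mx 0 j);
  C21_dxx : forall i j,
    {within A `*` setT, continuous (uncurry (dx j (dx i u)))};
  C21_ex_dt : forall x t, A x -> derivable (u x) t 1;
  C21_dt : {within A `*` setT, continuous (uncurry (dt u))} }.

End Parabolic.

Section System.
Context {R : realType} {N m : nat} (hN : (1 <= N)%N).
Implicit Types U : 'I_m -> 'rV[R]_N -> R -> R.

(* The functions U i are total on R^N x R; only their values on the closed
   half-space are constrained, here and in the predicates below.  The power
   a `^ r is the usual one (with 0 `^ r = 0 for r > 0) only for a >= 0, hence
   the notion is meant for nonnegative U. *)
Record classical_solution (r : R) (B : 'M[R]_m) U : Prop := {
  sol_C21 : forall i, C21 (half_space hN) (U i);
  sol_cont : forall i,
    {within half_space_cl hN `*` setT, continuous (uncurry (U i))};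
  sol_eq : forall i x t, half_space hN x ->
    dt (U i) x t - laplacian (U i) x t
    = \sum_(j < m) B i j * U i x t `^ r * U j x t `^ (r + 1);
  sol_bd : forall i x t, half_space_bd hN x -> U i x t = 0 }.

Definition nonnegative U : Prop :=
  forall i x t, half_space_cl hN x -> 0 <= U i x t.

Definition bounded_components U : Prop :=
  forall i, [bounded uncurry (U i) z | z in half_space_cl hN `*` setT].

Definition nontrivial U : Prop :=
  exists i x t, half_space_cl hN x /\ U i x t <> 0.

End System.

(* Main.v *)
(* Each component of the solution is compared with itself at two points [a], [b]
   of a line orthogonal to the boundary: the maximum principle is applied to
   [U i b t - k * U i a t] for an explicit factor [k].  The reaction is monotone in
   all components and homogeneous of degree [p], so at a first contact it costs
   at most [C * k * max (1 - k) 0 * U i a t].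

   Translations.  With [b = a + h e_1], the factor
   [k = exp (- (C + 1 / tau) h (1 + a_1 + h / 2))], [tau] the elapsed time, is
   preserved.  It comes from the rarefaction wave [(1 + x_1) / (2 tau)] of the
   Burgers equation satisfied by [- d_1 (ln u)]; being singular at [tau = 0], it needs
   no initial information, so that [d_1 u >= - (C + 1) (1 + x_1) u] for all times.

   Reflections.  With [b] the mirror image of [a] in [x_1 = lam], the factor
   [k = 1 - A (t) + mu exp (om tau + be (lam - a_1))] is preserved, the lower bound
   on [d_1 u] controlling the drift.  Its values go from below [1] to above [1],
   so [u (b) >= (1 - eta) u (a)] improves to [u (b) >= u (a)]; moving the plane by
   steps bounded below, [u] is nondecreasing in [x_1].  Then no defect is left
   ([eta = 0] and [d_1 u >= 0]) and the same factor gives [u >= (1 + c) u] from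
   distance [x_1] to distance [3 x_1], with [c > 0] independent of [x_1] by
   scaling.  Iterating contradicts boundedness, in every dimension. *)

Require Import Defs.
From mathcomp Require Import all_boot all_order all_algebra.
From mathcomp Require Import all_classical all_reals all_analysis.
From mathcomp Require Import ring lra.
Import Order.TTheory GRing.Theory Num.Theory.
Import numFieldNormedType.Exports.
Local Open Scope classical_set_scope.
Local Open Scope ring_scope.

(** * Bernoulli-type inequalities for real powers *)

Lemma bernoulli_powR (R : realType) (s r : R) : 0 <= s -> 1 <= r ->
  1 + r * (s - 1) <= s `^ r.
Proof.
move=> s0; rewrite le_eqVlt => /predU1P[<-|r1].
  by rewrite powRr1//; lra.
have r0 : 0 < r by lra.
have q0 : 0 < (1 - r^-1)^-1 by rewrite invr_gt0 subr_gt0 invf_lt1.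
(* Young's inequality for the product of [s] and 1, with exponent [r] and its conjugate. *)
have := conjugate_powR s0 ler01 r0 q0; rewrite invrK powR1 mul1r mulr1.
move=> /(_ ltac:(lra)) H.
have : r * s <= s `^ r + (r - 1).
  have := ler_wpM2l (ltW r0) H.
  by rewrite mulrDr mulrCA divff ?gt_eqF// mulrBr mulr1 divff ?gt_eqF// mulr1.
lra.
Qed.

(** Bernoulli at the ratio of [u] to [u + d] takes the place of the mean value theorem for the
    power, and covers [u = 0] as well. *)
Lemma powR_shift (R : realType) (r L u d : R) : 1 <= r -> 0 <= u -> 0 <= d ->
  u + d <= L -> (u + d) `^ r <= u `^ r + r * L `^ (r - 1) * d.
Proof.
move=> r1 u0 d0 uL.
have [->|ud0] := eqVneq (u + d) 0.
  rewrite powR0; last by lra.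
  by rewrite addr_ge0// ?powR_ge0// !mulr_ge0 ?powR_ge0//; lra.
have ud : 0 < u + d by rewrite lt_neqAle eq_sym ud0 addr_ge0.
have rE : (u + d) `^ r = (u + d) `^ (r - 1) * (u + d).
  rewrite -[X in _ = _ * X]powRr1 ?(ltW ud)// -powRD; last by rewrite ud0 implybT.
  by rewrite subrK.
have B : 1 + r * (u / (u + d) - 1) <= (u / (u + d)) `^ r.
  by apply: bernoulli_powR => //; rewrite divr_ge0// ltW.
have uE : u `^ r = (u / (u + d)) `^ r * (u + d) `^ r.
  by rewrite -powRM ?divr_ge0 ?(ltW ud)// divfK.
have P0 := powR_ge0 (u + d) (r - 1).
have PL : (u + d) `^ (r - 1) <= L `^ (r - 1).
  by apply: ge0_ler_powR; rewrite ?nnegrE//; lra.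
have step : (u + d) `^ r - u `^ r <= r * (u + d) `^ (r - 1) * d.
  have := ler_wpM2r (powR_ge0 (u + d) r) B; rewrite -uE {1}rE => H.
  have e : (1 + r * (u / (u + d) - 1)) * ((u + d) `^ (r - 1) * (u + d)) =
      (u + d) `^ r - r * (u + d) `^ (r - 1) * d.
    by rewrite rE; field.
  by rewrite e in H; lra.
have r0 : 0 <= r by lra.
have : r * (u + d) `^ (r - 1) * d <= r * L `^ (r - 1) * d.
  by rewrite ler_wpM2r// ler_wpM2l.
lra.
Qed.

(** * Calculus of one variable *)

(** Were [c] negative, [g1] would be negative just to the right of 0, and the mean value theorem
    would push [g] below its minimum. [g1] has to be differentiable at 0 only. *)
Lemma second_derivative_test (R : realType) (g g1 : R -> R) (c d : R) : 0 < d ->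
  (forall s : R, `|s| < d -> is_derive s 1 g (g1 s)) -> is_derive (0 : R) 1 g1 c ->
  (forall s, `|s| < d -> g 0 <= g s) -> g1 0 = 0 /\ 0 <= c.
Proof.
move=> d0 dg dg1 gmin.
have inI s : s \in `]-d, d[ -> `|s| < d by rewrite in_itv/= ltr_norml.
have g10 : g1 0 = 0.
  have H : is_derive (0 : R) 1 g 0.
    apply: (@derive1_at_min _ g (- d) d).
    - by lra.
    - by move=> s /inI sd; have [+ _] := dg _ sd; exact.
    - by rewrite in_itv/= oppr_lt0 d0.
    - by move=> s /inI; exact: gmin.
  have H' : is_derive (0 : R) 1 g (g1 0) by apply: dg; rewrite normr0.
  exact: etrans (esym (@derive_val _ _ _ _ _ _ _ H'))
    (@derive_val _ _ _ _ _ _ _ H).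
split=> //; rewrite leNgt; apply/negP => c0.
have [dv cE] := dg1.
have cv : (s^-1 *: (g1 s - g1 0)) @[s --> 0^'] --> c.
  rewrite -cE; apply: cvg_trans dv; apply: near_eq_cvg.
  by apply: nearW => s /=; rewrite addr0 /= scaler1.
have : \forall s \near 0^', s^-1 *: (g1 s - g1 0) < 0.
  by apply: (cvgr_lt c) => //.
rewrite near_withinE => /nbhs_ballP[e /= e0 He].
set h := Num.min (e / 2) (d / 2).
have h0 : 0 < h by rewrite lt_min; apply/andP; split; lra.
have he : h < e by rewrite gt_min; apply/orP; left; lra.
have hd : h < d by rewrite gt_min; apply/orP; right; lra.
have [| |x] := @MVT R g g1 0 h h0.
- move=> x; rewrite in_itv/= => /andP[x0 xh]; apply: dg.
  by rewrite gtr0_norm//; lra.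
- apply: derivable_within_continuous => x; rewrite in_itv/= => /andP[x0 xh].
  by have [+ _] := dg x ltac:(rewrite ger0_norm//; lra); exact.
rewrite in_itv/= subr0 => /andP[x0 xh] E.
have : x^-1 *: (g1 x - g1 0) < 0.
  apply: He; last by rewrite gt_eqF.
  by rewrite /ball/= sub0r normrN gtr0_norm//; lra.
rewrite g10 subr0 /GRing.scale/= => H.
have gx : g1 x < 0 by move: H; rewrite pmulr_rlt0 ?invr_gt0.
have := gmin h ltac:(rewrite gtr0_norm//).
have : g1 x * h < 0 by rewrite nmulr_rlt0.
by rewrite -E => *; lra.
Qed.

(** One-sided, because at a first contact only earlier times are available for comparison. *)
Lemma derive_le0_left (R : realType) (g : R -> R) (t t0 c : R) : t0 < t ->
  is_derive t 1 g c -> (forall s, t0 <= s < t -> g t <= g s) -> c <= 0.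
Proof.
move=> t0t [dv cE] gs; rewrite leNgt; apply/negP => c0.
have cv : (s^-1 *: (g (s + t) - g t)) @[s --> 0^'] --> c.
  rewrite -cE; apply: cvg_trans dv; apply: near_eq_cvg.
  by apply: nearW => s /=; rewrite scaler1.
have : \forall s \near 0^', 0 < s^-1 *: (g (s + t) - g t).
  by apply: (cvgr_gt c).
rewrite near_withinE => /nbhs_ballP[e /= e0 He].
set h := Num.min (e / 2) (t - t0).
have h0 : 0 < h by rewrite lt_min; apply/andP; split; lra.
have he : h < e by rewrite gt_min; apply/orP; left; lra.
have ht : h <= t - t0 by rewrite ge_min lexx orbT.
have : 0 < (- h)^-1 *: (g (- h + t) - g t).
  apply: He; last by rewrite oppr_eq0 gt_eqF.
  by rewrite /ball/= sub0r normrN normrN gtr0_norm.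
rewrite /GRing.scale/= invrN mulNr oppr_gt0 pmulr_rlt0 ?invr_gt0// subr_lt0.
by rewrite ltNge gs//; apply/andP; split; lra.
Qed.

Lemma derive_ge0_right (R : realType) (g : R -> R) (t t1 c : R) : t < t1 ->
  is_derive t 1 g c -> (forall s, t < s <= t1 -> g t <= g s) -> 0 <= c.
Proof.
move=> tt1 [dv cE] gs; rewrite leNgt; apply/negP => c0.
have cv : (s^-1 *: (g (s + t) - g t)) @[s --> 0^'] --> c.
  rewrite -cE; apply: cvg_trans dv; apply: near_eq_cvg.
  by apply: nearW => s /=; rewrite scaler1.
have : \forall s \near 0^', s^-1 *: (g (s + t) - g t) < 0.
  by apply: (cvgr_lt c).
rewrite near_withinE => /nbhs_ballP[e /= e0 He].
set h := Num.min (e / 2) (t1 - t).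
have h0 : 0 < h by rewrite lt_min; apply/andP; split; lra.
have he : h < e by rewrite gt_min; apply/orP; left; lra.
have ht : h <= t1 - t by rewrite ge_min lexx orbT.
have : h^-1 *: (g (h + t) - g t) < 0.
  apply: He; last by rewrite gt_eqF.
  by rewrite /ball/= sub0r normrN gtr0_norm.
rewrite /GRing.scale/= pmulr_rlt0 ?invr_gt0// subr_lt0.
by rewrite ltNge gs//; apply/andP; split; lra.
Qed.

Lemma cont_pair (T U V : topologicalType) (f : T -> U) (g : T -> V) z :
  {for z, continuous f} -> {for z, continuous g} ->
  {for z, continuous (fun z => (f z, g z))}.
Proof. by move=> cf cg; apply: cvg_pair; [exact: cf|exact: cg]. Qed.

(** Abstract maximum principle for a weakly coupled system. The points of [B] and times in
    [[t0, t1]] where some component is nonpositive form a compact set; if it is nonempty it has an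
    earliest time, at which all components are still nonnegative on [A]. The space [X] is general so
    that it can also consist of pairs [(x, h)]. *)
Lemma first_contact (R : realType) (X : topologicalType) (m : nat)
    (Z : 'I_m -> X -> R -> R) (A B : set X) (t0 t1 : R) :
  compact B -> B `<=` A ->
  (forall i x t, t0 <= t <= t1 -> {for (x, t), continuous (uncurry (Z i))}) ->
  (forall i x t, A x -> t0 <= t <= t1 -> Z i x t <= 0 -> B x) ->
  (forall i x, A x -> 0 < Z i x t0) ->
  (forall i x t, B x -> t0 < t -> t <= t1 -> Z i x t = 0 ->
     (forall j y, A y -> 0 <= Z j y t) ->
     (forall s, t0 <= s < t -> 0 < Z i x s) -> False) ->
  forall i x t, A x -> t0 <= t <= t1 -> 0 < Z i x t.
Proof.
move=> cB BA cZ outB Z0 contact i x t Ax tt; rewrite ltNge; apply/negP => Zn.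
have t01 : t0 <= t1 by move: tt => /andP[]; exact: le_trans.
(* Continuity is given at times in [[t0, t1]] only; clamping the time makes every component
   continuous everywhere, so that the sublevel set is closed. *)
pose clamp s : R := Num.max t0 (Num.min s t1).
have clampE s : t0 <= s <= t1 -> clamp s = s.
  by move=> /andP[s0 s1]; rewrite /clamp min_l// max_r.
have clampI s : t0 <= clamp s <= t1.
  by rewrite /clamp le_max lexx/= ge_max t01 ge_min lexx orbT.
have cclamp : continuous clamp.
  move=> s; apply: (@continuous_max _ _ (fun=> t0) (fun s => Num.min s t1)).
    exact: cst_continuous.
  by apply: (@continuous_min _ _ id (fun=> t1)) => //; exact: cst_continuous.
pose W j (z : X * R) := Z j z.1 (clamp z.2).
have cW j : continuous (W j).
  move=> [y s].
  apply: (@continuous_comp _ _ _ (fun z : X * R => (z.1, clamp z.2))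
    (uncurry (Z j))); last by apply: cZ; exact: clampI.
  apply: cont_pair; first exact: cvg_fst.
  by apply: continuous_comp; [exact: cvg_snd|exact: cclamp].
pose S := \big[setU/set0]_(j <- index_enum 'I_m)
  (W j @^-1` [set r : R | r <= 0]).
have SE z : S z <-> exists j, W j z <= 0.
  rewrite /S -bigcup_seq; split.
    by move=> [j _ Wj]; exists j.
  by move=> [j Wj]; exists j => //=; rewrite mem_index_enum.
pose K : set (X * R) := (B `*` `[t0, t1]) `&` S.
have cK : compact K.
  have cBI : compact (B `*` `[t0, t1] : set (X * R)).
    by apply: compact_setX => //; exact: segment_compact.
  have cS : closed S.
    apply: closed_bigsetU => j _; apply: preimage_closed.
      by move=> z _; exact: cW.
    exact: closed_le.
  exact: compact_closedI.
have K0 : K !=set0.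
  exists (x, t); split; first by split => /=; [exact: outB Zn|rewrite in_itv].
  by apply/SE; exists i; rewrite /W/= clampE.
have [|[y s] yK ymin] := @compact_EVT_min _ R snd K K0 cK.
  by apply: continuous_subspaceT => z; exact: cvg_snd.
move: yK; rewrite inE => -[[/= By sI]]; rewrite in_itv/= in sI.
move=> /SE[j]; rewrite /W/= clampE// => Zy.
have pos k w r : A w -> t0 <= r < s -> 0 < Z k w r.
  move=> Aw /andP[r0 rs]; rewrite ltNge; apply/negP => Zw.
  have rI : t0 <= r <= t1 by rewrite r0; move: sI => /andP[_]; lra.
  have : s <= r.
    apply: (ymin (w, r)); rewrite inE; split.
      by split => /=; [exact: outB Zw|rewrite in_itv].
    by apply/SE; exists k; rewrite /W/= clampE.
  by lra.
move: (sI) => /andP[s0 s1].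
have t0s : t0 < s.
  rewrite lt_neqAle s0 andbT; apply/eqP => t0s.
  by have := Z0 j y (BA _ By); rewrite t0s; lra.
(* Positivity is known strictly before [s]; it passes to the limit from the left as
   nonnegativity. *)
have nn k w : A w -> 0 <= Z k w s.
  move=> Aw; have cw : Z k w r @[r --> s^'-] --> Z k w s.
    apply: (@cvg_at_left_filter _ _ (Z k w)).
    have := cZ k w s sI; rewrite /prop_for/= => c.
    apply: (@continuous_comp _ _ _ (fun r : R => (w, r)) (uncurry (Z k))) => //.
    apply: (@cont_pair _ _ _ (cst w) id); last exact: cvg_id.
    exact: cst_continuous.
  apply: (cvgr_to_ge cw).
  near=> r; apply/ltW/pos => //; apply/andP; split; near: r.
    by apply: nbhs_left_ge.
  exact: nbhs_left_lt.
apply: (contact j y s) => //.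
- by apply/eqP; rewrite eq_le Zy nn//; exact: BA.
- by move=> r rs; apply: pos => //; exact: BA.
Unshelve. all: end_near.
Qed.

(** * The reaction term *)

(** By homogeneity, replacing [a], [b] by [k * a], [k * b] multiplies the term by [k ^ (2 r + 1)],
    and Bernoulli gives [k ^ (2 r + 1) >= k - 2 r k max (1 - k) 0]. Removing the shift [d] costs a
    Lipschitz constant. *)
Lemma reaction_term_compare (R : realType) (r M : R) : 1 <= r -> 0 <= M ->
  exists2 D : R, 0 <= D & forall a b v w k d : R,
    0 <= a <= M -> 0 <= b <= M -> 0 <= v <= M -> 0 <= w <= M ->
    0 <= k -> 0 <= d <= 2 * M -> k * a <= v + d -> k * b <= w + d ->
    k * (a `^ r * b `^ (r + 1)) - D * (k * Num.max (1 - k) 0 * a + d)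
      <= v `^ r * w `^ (r + 1).
Proof.
(* [3 * M] bounds [v + d] and [w + d], since [d <= 2 * M]. *)
move=> r1 M0; pose L := 3 * M; pose E := L `^ (r - 1) * L `^ (r + 1).
pose F := (r + 1) * (L `^ r * L `^ r) + r * E.
have E0 : 0 <= E by rewrite mulr_ge0// powR_ge0.
have F0 : 0 <= F.
  by rewrite addr_ge0// !mulr_ge0 ?powR_ge0//; lra.
exists (2 * r * E + F); first by apply: addr_ge0 => //; apply: mulr_ge0 => //; lra.
move=> a b v w k d /andP[a0 aM] /andP[b0 bM] /andP[v0 vM] /andP[w0 wM] k0.
move=> /andP[d0 dM] ka kb.
have mono s x y : 0 <= s -> 0 <= x -> x <= y -> x `^ s <= y `^ s.
  move=> s0 x0 xy; apply: ge0_ler_powR; rewrite ?nnegrE//.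
  exact: le_trans x0 xy.
have LE x s : 0 <= s -> 0 <= x -> x <= L -> x `^ s <= L `^ s.
  by move=> *; exact: mono.
set T := a `^ r * b `^ (r + 1).
have T0 : 0 <= T by rewrite mulr_ge0 ?powR_ge0.
(* Since [r >= 1], one power of [a] can be split off: the loss is then proportional to [a], hence
   can be absorbed by terms linear in the solution. *)
have TE : T <= E * a.
  have -> : T = (a `^ (r - 1) * b `^ (r + 1)) * a.
    have aE : a `^ r = a `^ (r - 1) * a `^ 1.
      by rewrite -powRD ?subrK// gt_eqF//; lra.
    by rewrite /T aE powRr1// mulrAC.
  by rewrite ler_wpM2r// ler_pM ?powR_ge0// LE// /L; lra.
have low : k `^ r * k `^ (r + 1) * T <= (v + d) `^ r * (w + d) `^ (r + 1).
  have -> : k `^ r * k `^ (r + 1) * T = (k * a) `^ r * (k * b) `^ (r + 1).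
    by rewrite !powRM// /T; ring.
  by rewrite ler_pM ?powR_ge0// mono// ?mulr_ge0//; lra.
have up : (v + d) `^ r * (w + d) `^ (r + 1) <= v `^ r * w `^ (r + 1) + F * d.
  have S1 := @powR_shift R r L v d r1 v0 d0 ltac:(rewrite /L; lra).
  have S2 := @powR_shift R (r + 1) L w d ltac:(lra) w0 d0 ltac:(rewrite /L; lra).
  rewrite addrK in S2.
  have V := LE v r ltac:(lra) v0 ltac:(rewrite /L; lra).
  have W := LE (w + d) (r + 1) ltac:(lra) ltac:(lra) ltac:(rewrite /L; lra).
  have q1 : (v + d) `^ r * (w + d) `^ (r + 1) <=
      v `^ r * (w + d) `^ (r + 1) + (r * L `^ (r - 1) * d) * L `^ (r + 1).
    apply: le_trans (ler_wpM2r (powR_ge0 _ _) S1) _.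
    by rewrite mulrDl lerD2l ler_wpM2l// !mulr_ge0 ?powR_ge0//; lra.
  have q2 : v `^ r * (w + d) `^ (r + 1) <=
      v `^ r * w `^ (r + 1) + L `^ r * ((r + 1) * L `^ r * d).
    apply: le_trans (ler_wpM2l (powR_ge0 _ _) S2) _.
    by rewrite mulrDr lerD2l ler_wpM2r// !mulr_ge0 ?powR_ge0//; lra.
  apply: le_trans q1 _.
  have -> : F * d = L `^ r * ((r + 1) * L `^ r * d) +
      r * L `^ (r - 1) * d * L `^ (r + 1) by rewrite /F /E; ring.
  by rewrite addrA lerD2r.
have kk : k - 2 * r * (k * Num.max (1 - k) 0) <= k `^ r * k `^ (r + 1).
  have B := @bernoulli_powR R k (2 * r) k0 ltac:(lra).
  have -> : k `^ r * k `^ (r + 1) = k * k `^ (2 * r).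
    rewrite -powRD; last by rewrite gt_eqF//; lra.
    have -> : r + (r + 1) = 2 * r + 1 by ring.
    by rewrite powRD ?powRr1 1?mulrC//; apply/implyP; lra.
  have : k * (1 + 2 * r * (k - 1)) <= k * k `^ (2 * r) by rewrite ler_wpM2l.
  apply: le_trans.
  have : 2 * r * k * (1 - k) <= 2 * r * k * Num.max (1 - k) 0.
    by rewrite ler_wpM2l ?le_max ?lexx// !mulr_ge0//; lra.
  lra.
have kkT := ler_wpM2r T0 kk.
set K := k * Num.max (1 - k) 0 in kk kkT *.
have K0 : 0 <= K by rewrite mulr_ge0// le_max lexx orbT.
clearbody K E T.
have rK : 2 * r * K * T <= 2 * r * K * (E * a).
  by rewrite ler_wpM2l// !mulr_ge0//; lra.
clearbody F.
have e1 : 0 <= F * (K * a) by rewrite !mulr_ge0.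
have e2 : 0 <= 2 * r * E * d by rewrite !mulr_ge0//; lra.
have -> : (2 * r * E + F) * (K * a + d) =
  2 * r * K * (E * a) + F * d + F * (K * a) + 2 * r * E * d by ring.
rewrite mulrBl in kkT.
have := le_trans (le_trans kkT low) up.
lra.
Qed.

Definition reaction (R : realType) (m : nat) (r : R) (B : 'M[R]_m)
  (i : 'I_m) (U : 'I_m -> R) : R :=
  \sum_(j < m) B i j * U i `^ r * U j `^ (r + 1).

(** The comparison arguments know the nonlinearity through this inequality alone. The weights being
    nonnegative, the bounds for single terms add up, and the total of all entries serves every
    row. *)
Lemma reaction_compare (R : realType) (m : nat) (r M : R) (B : 'M[R]_m) :
  1 <= r -> 0 <= M -> (forall i j, 0 <= B i j) ->
  exists2 C : R, 0 <= C & forall i (U V : 'I_m -> R) (k d : R),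
    (forall j, 0 <= U j <= M) -> (forall j, 0 <= V j <= M) ->
    0 <= k -> 0 <= d <= 2 * M -> (forall j, k * U j <= V j + d) ->
    k * reaction R m r B i U - C * (k * Num.max (1 - k) 0 * U i + d)
      <= reaction R m r B i V.
Proof.
move=> r1 M0 B0; have [D D0 HD] := reaction_term_compare R r M r1 M0.
pose S := \sum_i \sum_j B i j.
have S0 : 0 <= S by apply: sumr_ge0 => i _; apply: sumr_ge0.
exists (S * D); first exact: mulr_ge0.
move=> i U V k d HU HV k0 dd kUV.
set H := k * Num.max (1 - k) 0 * U i + d.
have H0 : 0 <= H.
  rewrite addr_ge0//; last by case/andP: dd.
  by rewrite !mulr_ge0// ?le_max ?lexx ?orbT//; case/andP: (HU i).
have le1 : k * reaction R m r B i U - (\sum_j B i j) * (D * H) <=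
    reaction R m r B i V.
  rewrite /reaction mulr_sumr mulr_suml -sumrB; apply: ler_sum => j _.
  have := HD (U i) (U j) (V i) (V j) k d (HU i) (HU j) (HV i) (HV j) k0 dd
    (kUV i) (kUV j).
  rewrite -/H => /(ler_wpM2l (B0 i j)); rewrite mulrBr.
  have -> : k * (B i j * U i `^ r * U j `^ (r + 1)) =
    B i j * (k * (U i `^ r * U j `^ (r + 1))) by ring.
  by rewrite -[X in _ -> _ <= X]mulrA.
apply: le_trans le1; rewrite lerD2l lerN2 -mulrA.
rewrite ler_wpM2r ?mulr_ge0// /S [leRHS](bigD1 i)//= lerDl.
by apply: sumr_ge0 => i' _; apply: sumr_ge0.
Qed.

(** * Two-point comparison at a contact point *)

(** Squared Euclidean norm, used as a smooth penalty: its second derivative in each coordinate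
    direction is 2, and a bound on it confines a point to a compact set. *)
Definition sqn (R : realType) (N : nat) (x : 'rV[R]_N) : R :=
  \sum_(k < N) x 0 k ^+ 2.

Lemma sqn_ge0 (R : realType) (N : nat) (x : 'rV[R]_N) : 0 <= sqn R N x.
Proof. by apply: sumr_ge0 => k _; exact: sqr_ge0. Qed.

Lemma coord_shift (R : realType) (N : nat) (x : 'rV[R]_N) (s : R) (k l : 'I_N) :
  (x + s *: delta_mx 0 k) 0 l = x 0 l + s * (l == k)%:R.
Proof. by rewrite !mxE eqxx. Qed.

Lemma sqn_shift (R : realType) (N : nat) (x : 'rV[R]_N) (s : R) (k : 'I_N) :
  sqn R N (x + s *: delta_mx 0 k) = sqn R N x + (2 * x 0 k * s + s ^+ 2).
Proof.
rewrite /sqn (bigD1 k)//= [in RHS](bigD1 k)//= coord_shift eqxx mulr1.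
under eq_bigr => l lk do rewrite coord_shift (negbTE lk) mulr0 addr0.
by ring.
Qed.

Lemma sqr_coord_le_sqn (R : realType) (N : nat) (x : 'rV[R]_N) (k : 'I_N) :
  x 0 k ^+ 2 <= sqn R N x.
Proof.
rewrite /sqn (bigD1 k)//= lerDl; apply: sumr_ge0 => l _; exact: sqr_ge0.
Qed.

Lemma is_derive_line (R : realType) (N : nat) (f : 'rV[R]_N -> R)
    (x v : 'rV[R]_N) (s : R) : derivable f (x + s *: v) v ->
  is_derive s 1 (fun s => f (x + s *: v)) ('D_v f (x + s *: v)).
Proof.
move=> df; have E : (fun h : R => h^-1 *: (((fun s => f (x + s *: v)) \o shift s)
    (h *: 1) - f (x + s *: v))) =
    (fun h : R => h^-1 *: ((f \o shift (x + s *: v)) (h *: v) - f (x + s *: v))).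
  apply/funext => h /=; congr (_ *: (f _ - _)).
  by rewrite [h *: 1]mulr1 scalerDl addrCA.
by split; rewrite /derivable /derive E.
Qed.

Lemma is_derive_twopoint (R : realType) (p k q r : R -> R) (s p1 k1 q1 r1 : R) :
  is_derive s 1 p p1 -> is_derive s 1 k k1 -> is_derive s 1 q q1 ->
  is_derive s 1 r r1 ->
  is_derive s 1 (fun s => p s - k s * q s + r s) (p1 - (k1 * q s + k s * q1) + r1).
Proof.
move=> dp dk dq dr.
have := is_deriveD (is_deriveB dp (is_deriveM dk dq)) dr.
by rewrite /GRing.scale/= [k s * q1 + _]addrC [q s * k1]mulrC.
Qed.

Lemma is_derive_decay (R : realType) (c0 c1 y s : R) :
  is_derive s 1 (fun s => c0 + c1 * expR (- y * s)) (- y * (c1 * expR (- y * s))).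
Proof.
have d1 : is_derive s 1 (fun s => - y * s) (- y).
  have := is_deriveZ (- y) (is_derive_id s (1 : R)).
  by rewrite [_ *: 1]mulr1.
have d2 := is_derive1_comp (is_derive_expR (- y * s)) d1.
have := is_deriveD (is_derive_cst c0 s 1) (is_deriveZ c1 d2).
rewrite add0r => d; apply: is_derive_eq d _.
by rewrite /GRing.scale/=; ring.
Qed.

Lemma is_derive_quadratic (R : realType) (e1 e2 s : R) :
  is_derive s 1 (fun s => e1 * s + e2 * s ^+ 2) (e1 + 2 * e2 * s).
Proof.
have d := is_derive_id s (1 : R).
have := is_deriveD (is_deriveZ e1 d) (is_deriveZ e2 (is_deriveM d d)).
move=> dd; apply: is_derive_eq dd _.
by rewrite /GRing.scale/=; ring.
Qed.

Section Contact.
Context {R : realType} {N : nat} (hN : (1 <= N)%N).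
Let i0 := Ordinal hN.

(** First and second order conditions for a minimum along a line. The factor
    [c0 + c1 * expR (- y * s)] covers translations ([c0 = 0]), reflections, and directions in which
    the factor is constant ([y = 0]); the sign [sg] disappears from the second derivative. *)
Lemma contact_direction (u : 'rV[R]_N -> R -> R) (a b : 'rV[R]_N)
    (t sg c0 c1 y E d : R) (k : 'I_N) :
  C21 (half_space hN) u -> 0 < d -> d <= a 0 i0 -> d <= b 0 i0 -> sg ^+ 2 = 1 ->
  (forall s : R, `|s| < d -> u b t - (c0 + c1) * u a t + E * sqn R N b <=
    u (b + (sg * s) *: delta_mx 0 k) t
    - (c0 + c1 * expR (- y * s)) * u (a + s *: delta_mx 0 k) t
    + E * sqn R N (b + (sg * s) *: delta_mx 0 k)) ->
  sg * dx k u b t + y * c1 * u a t - (c0 + c1) * dx k u a t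
    + 2 * E * sg * b 0 k = 0 /\
  0 <= dx k (dx k u) b t - y ^+ 2 * c1 * u a t + 2 * y * c1 * dx k u a t
    - (c0 + c1) * dx k (dx k u) a t + 2 * E.
Proof.
move=> cu d0 da db sg2 gmin; set e : 'rV[R]_N := delta_mx 0 k.
have in_half (x : 'rV[R]_N) (s : R) : d <= x 0 i0 -> `|s| < d -> half_space hN (x + s *: e).
  rewrite /half_space/= coord_shift => dx; rewrite ltr_norml => /andP[s1 s2].
  by case: (_ == _); rewrite ?(mulr1, mulr0); lra.
have sgn (s : R) : `|sg * s| = `|s|.
  by rewrite normrM; have /eqP := sg2; rewrite sqrf_eq1 => /orP[]/eqP->;
    rewrite ?normrN normr1 mul1r.
have der (x : 'rV[R]_N) (s : R) (f : 'rV[R]_N -> R -> R) : d <= x 0 i0 -> `|s| < d ->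
    (forall x t, half_space hN x -> derivable (f^~ t) x e) ->
    is_derive s 1 (fun s => f (x + s *: e) t) (dx k f (x + s *: e) t).
  move=> dx sd df.
  exact: (is_derive_line R N (f^~ t) x e s (df _ t (in_half _ _ dx sd))).
have dsg (s : R) : is_derive s 1 (fun s => sg * s) sg.
  by have := is_deriveZ sg (is_derive_id s (1 : R)); rewrite [_ *: 1]mulr1.
have derb (s : R) (f : 'rV[R]_N -> R -> R) : `|s| < d ->
    (forall x t, half_space hN x -> derivable (f^~ t) x e) ->
    is_derive s 1 (fun s => f (b + (sg * s) *: e) t)
      (dx k f (b + (sg * s) *: e) t * sg).
  move=> sd df; apply: (@is_derive1_comp _ (fun s => f (b + s *: e) t)) => //.
  by apply: der => //; rewrite sgn.
have du (x : 'rV[R]_N) (t' : R) : half_space hN x -> derivable (u^~ t') x e by exact: C21_ex_dx cu _ _ _.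
have ddu (x : 'rV[R]_N) (t' : R) : half_space hN x -> derivable ((dx k u)^~ t') x e.
  exact: C21_ex_dxx cu _ _ _ _.
pose g (s : R) := u (b + (sg * s) *: e) t - (c0 + c1 * expR (- y * s)) * u (a + s *: e) t
  + ((E * (2 * b 0 k * sg)) * s + E * s ^+ 2).
pose g1 (s : R) := dx k u (b + (sg * s) *: e) t * sg
  - (- y * (c1 * expR (- y * s)) * u (a + s *: e) t
     + (c0 + c1 * expR (- y * s)) * dx k u (a + s *: e) t)
  + (E * (2 * b 0 k * sg) + 2 * E * s).
have dg (s : R) : `|s| < d -> is_derive s 1 g (g1 s).
  move=> sd; apply: is_derive_twopoint.
  - exact: derb.
  - exact: is_derive_decay.
  - exact: der.
  - exact: is_derive_quadratic.
pose c := dx k (dx k u) b t - y ^+ 2 * c1 * u a t + 2 * y * c1 * dx k u a t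
    - (c0 + c1) * dx k (dx k u) a t + 2 * E.
have n0 : `|0 : R| < d by rewrite normr0.
have E0 (x : 'rV[R]_N) : x + (0 : R) *: e = x by rewrite scale0r addr0.
have dg1 : is_derive (0 : R) 1 g1 c.
  (* [g1] is the sum of two functions of two-point form: [dA] carries the derivatives of [u], [dB]
     the derivative of the factor. *)
  have dB := is_derive_twopoint R _ _ _ _ 0 _ _ _ _ (is_derive_cst (0 : R) (0 : R) (1 : R))
    (is_derive_decay R 0 (- y * c1) y 0) (der a 0 _ da n0 du)
    (is_derive_cst (E * (2 * b 0 k * sg)) (0 : R) (1 : R)).
  have dC : is_derive (0 : R) 1 (fun s => sg * dx k u (b + (sg * s) *: e) t)
      (sg * (dx k (dx k u) (b + (sg * 0) *: e) t * sg)).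
    by have := is_deriveZ sg (derb 0 _ n0 ddu); exact.
  have dA := is_derive_twopoint R _ _ _ _ 0 _ _ _ _ dC
    (is_derive_decay R c0 c1 y 0) (der a 0 _ da n0 ddu)
    (is_derive_quadratic R (2 * E) 0 0).
  have := is_deriveD dA dB.
  set h := (X in is_derive _ _ X _); have -> : h = g1.
    by apply/funext => s; rewrite /h /g1 fctE /=; ring.
  move=> dh; apply: is_derive_eq dh _.
  rewrite /c !mulr0 !E0 expR0 [sg * (_ * sg)]mulrCA -expr2 sg2.
  move: (dx k (dx k u) b t) (dx k (dx k u) a t) (dx k u a t) (u a t) => *.
  by ring.
have [|H1 H2] := second_derivative_test R g g1 c d d0 dg dg1.
  move=> s sd; have := gmin s sd; rewrite -/e !sqn_shift /g mulr0 !E0 mulr0 expR0.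
  rewrite exprMn sg2 mul1r => H.
  rewrite mulr1 !mulr0 expr0n/= !mulr0 !addr0.
  have -> : E * (2 * b 0 k * sg) * s = E * (2 * b 0 k * (sg * s)) by ring.
  by lra.
split; last exact: H2.
by rewrite -[RHS]H1 /g1 !mulr0 !E0 expR0; ring.
Qed.

(* The pair [(a, b)] is displaced by [(s e_1, sg s e_1)]: [sg = 1] for
   translations and [sg = -1] for reflections. *)
Lemma contact_inequality (u : 'rV[R]_N -> R -> R) (a b : 'rV[R]_N)
    (t0 t sg c0 c1 y E d : R) (k P : R -> R) (k' P' : R) :
  C21 (half_space hN) u -> 0 < d -> d <= a 0 i0 -> d <= b 0 i0 -> sg ^+ 2 = 1 ->
  (forall s : R, `|s| < d -> u b t - (c0 + c1) * u a t + E * sqn R N b <=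
    u (b + (sg * s) *: delta_mx 0 i0) t
    - (c0 + c1 * expR (- y * s)) * u (a + s *: delta_mx 0 i0) t
    + E * sqn R N (b + (sg * s) *: delta_mx 0 i0)) ->
  (forall (l : 'I_N) (s : R), l != i0 -> u b t - (c0 + c1) * u a t + E * sqn R N b <=
    u (b + s *: delta_mx 0 l) t - (c0 + c1) * u (a + s *: delta_mx 0 l) t
    + E * sqn R N (b + s *: delta_mx 0 l)) ->
  is_derive t 1 k k' -> is_derive t 1 P P' -> k t = c0 + c1 -> t0 < t ->
  (forall s, t0 <= s < t ->
    u b t - k t * u a t + P t <= u b s - k s * u a s + P s) ->
  sg * dx i0 u b t + y * c1 * u a t - (c0 + c1) * dx i0 u a t
    + 2 * E * sg * b 0 i0 = 0 /\
  (dt u b t - laplacian u b t) - (c0 + c1) * (dt u a t - laplacian u a t)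
    - k' * u a t + P' + y ^+ 2 * c1 * u a t - 2 * y * c1 * dx i0 u a t
    - 2 * N%:R * E <= 0.
Proof.
move=> cu d0 da db sg2 min0 mink dk dP kt t0t minT.
have [H1 H2] := contact_direction u a b t sg c0 c1 y E d i0 cu d0 da db sg2 min0.
split=> //.
have ha : half_space hN a by rewrite /half_space/=; exact: lt_le_trans da.
have hb : half_space hN b by rewrite /half_space/=; exact: lt_le_trans db.
have HT : dt u b t - (k' * u a t + k t * dt u a t) + P' <= 0.
  have dua := derivableP (@C21_ex_dt _ _ _ _ cu a t ha).
  have dub := derivableP (@C21_ex_dt _ _ _ _ cu b t hb).
  have D := is_derive_twopoint R _ _ _ _ t _ _ _ _ dub dk dua dP.
  exact: derive_le0_left t0t D minT.
have HL : 0 <= laplacian u b t - (c0 + c1) * laplacian u a t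
    - y ^+ 2 * c1 * u a t + 2 * y * c1 * dx i0 u a t + 2 * N%:R * E.
  (* The factor varies along [i0] only; [X] collects what this adds to the sum over all
     directions. *)
  pose X := - y ^+ 2 * c1 * u a t + 2 * y * c1 * dx i0 u a t.
  have : 0 <= \sum_(l < N) (dx l (dx l u) b t - (c0 + c1) * dx l (dx l u) a t
      + 2 * E + (if l == i0 then X else 0)).
    apply: sumr_ge0 => l _; have [->|li] := eqVneq l i0.
      move: H2; rewrite /X; clear.
      move: (dx i0 (dx i0 u) b t) (dx i0 (dx i0 u) a t) (dx i0 u a t) (u a t).
      by move=> *; lra.
    (* In the other directions both points move alike and the factor is constant: sign 1 and rate
       0. *)
    have [|_] := contact_direction u a b t 1 (c0 + c1) 0 0 E d l cu d0 da db
        (expr1n _ _).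
      move=> s sd; have := mink l s li; rewrite !mul0r addr0 mul1r; clear.
      move: (u b t) (u a t) (u _ t) (u (a + _) t) => *; lra.
    rewrite !(mul0r, mulr0, addr0, subr0).
    exact.
  rewrite !big_split/= -big_mkcond big_pred1_eq sumr_const card_ord sumrN -mulr_sumr.
  have -> : (2 * E) *+ N = 2 * N%:R * E by rewrite -mulr_natr; ring.
  have aux (Lb La D V : R) :
      0 <= Lb - (c0 + c1) * La + 2 * N%:R * E + (- y ^+ 2 * c1 * V + 2 * y * c1 * D) ->
      0 <= Lb - (c0 + c1) * La - y ^+ 2 * c1 * V + 2 * y * c1 * D + 2 * N%:R * E.
    by clear; lra.
  exact: aux.
rewrite kt in HT; move: HL HT; clear.
move: (laplacian u b t) (laplacian u a t) (dx i0 u a t) (u a t) (dt u b t).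
by move: (dt u a t) => *; lra.
Qed.

End Contact.

(** * Pointwise continuity of real-valued expressions *)

Section RealContinuity.
Context {R : realType} {T : topologicalType}.
Implicit Types (f g : T -> R) (z : T).

Lemma cont_add f g z : {for z, continuous f} -> {for z, continuous g} ->
  {for z, continuous (fun z => f z + g z)}.
Proof. by move=> cf cg; exact: cvgD. Qed.

Lemma cont_sub f g z : {for z, continuous f} -> {for z, continuous g} ->
  {for z, continuous (fun z => f z - g z)}.
Proof. by move=> cf cg; exact: cvgB. Qed.

Lemma cont_mul f g z : {for z, continuous f} -> {for z, continuous g} ->
  {for z, continuous (fun z => f z * g z)}.
Proof. by move=> cf cg; exact: cvgM. Qed.

Lemma cont_inv f z : {for z, continuous f} -> f z != 0 ->
  {for z, continuous (fun z => (f z)^-1)}.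
Proof. by move=> cf fz; exact: cvgV. Qed.

Lemma cont_opp f z : {for z, continuous f} -> {for z, continuous (fun z => - f z)}.
Proof. by move=> cf; exact: cvgN. Qed.

Lemma cont_expR f z : {for z, continuous f} ->
  {for z, continuous (fun z => expR (f z))}.
Proof.
by move=> cf; apply: (@continuous_comp _ _ _ f expR) => //; exact: continuous_expR.
Qed.

Lemma cont_cst (c : R) z : {for z, continuous (fun _ : T => c)}.
Proof. exact: cst_continuous. Qed.

Lemma cont_max0 f z : {for z, continuous f} ->
  {for z, continuous (fun z => Num.max (f z) 0)}.
Proof.
move=> cf; apply: (@continuous_max _ _ f (fun=> 0)) => //; exact: cst_continuous.
Qed.

Lemma cont_sum (I : finType) (f : I -> T -> R) z :
  (forall i, {for z, continuous (f i)}) ->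
  {for z, continuous (fun z => \sum_i f i z)}.
Proof.
move=> cf; elim: (index_enum I) => [|i s IHs].
  have E : (fun=> 0) = (fun z => \sum_(i <- [::]) f i z).
    by apply/funext => y; rewrite big_nil.
  by have := cont_cst (0 : R) z; rewrite /prop_for E.
have E : (fun z => f i z + \sum_(j <- s) f j z) =
    (fun z => \sum_(j <- i :: s) f j z).
  by apply/funext => y; rewrite big_cons.
by have := cont_add _ _ _ (cf i) IHs; rewrite /prop_for E.
Qed.

Lemma cont_shift (N : nat) (f : T -> 'rV[R]_N) (g : T -> R) (v : 'rV[R]_N) z :
  {for z, continuous f} -> {for z, continuous g} ->
  {for z, continuous (fun z => f z + g z *: v)}.
Proof. by move=> cf cg; apply: cvgD => //; exact: cvgZr_tmp. Qed.

End RealContinuity.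

(** * Topology of the half-space: retraction, extension and compact boxes *)

Section HalfSpaceTopology.
Context {R : realType} {N : nat} (hN : (1 <= N)%N).
Let i0 := Ordinal hN.

(** Nearest-point retraction onto the closed half-space. Composition with it turns continuity within
    the closed half-space into continuity everywhere, the form that [first_contact] asks for. *)
Definition half_proj (x : 'rV[R]_N) : 'rV[R]_N :=
  x + (Num.max (x 0 i0) 0 - x 0 i0) *: delta_mx 0 i0.

Lemma half_proj_id (x : 'rV[R]_N) : 0 <= x 0 i0 -> half_proj x = x.
Proof. by move=> x0; rewrite /half_proj max_l// subrr scale0r addr0. Qed.

Lemma half_space_clE (x : 'rV[R]_N) : half_space_cl hN x <-> 0 <= x 0 i0.
Proof.
rewrite /half_space_cl /half_space /half_space_bd; split.
  by move=> [/= /ltW//|/= ->].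
by rewrite le_eqVlt => /predU1P[/esym|] H; [right|left].
Qed.

Lemma half_proj_cl (x : 'rV[R]_N) : half_space_cl hN (half_proj x).
Proof.
by apply/half_space_clE; rewrite coord_shift eqxx mulr1 subrKC le_max lexx orbT.
Qed.

Lemma continuous_coord (k : 'I_N) : continuous (fun x : 'rV[R]_N => x 0 k).
Proof. exact: coord_continuous. Qed.

Lemma continuous_half_proj : continuous half_proj.
Proof.
move=> x; apply: (cont_shift N id (fun x : 'rV[R]_N => Num.max (x 0 i0) 0 - x 0 i0)).
  exact: cvg_id.
apply: cont_sub; last exact: continuous_coord.
by apply: cont_max0; exact: continuous_coord.
Qed.

Lemma continuous_sqn : continuous (sqn R N).
Proof.
by move=> x; apply: cont_sum => k; apply: cont_mul; exact: continuous_coord.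
Qed.

Lemma continuous_extension (u : 'rV[R]_N -> R -> R) :
  {within half_space_cl hN `*` setT, continuous (uncurry u)} ->
  continuous (uncurry (fun x t => u (half_proj x) t)).
Proof.
move=> /subspace_continuousP cu.
pose f (z : 'rV[R]_N * R) := (half_proj z.1, z.2).
have fc : continuous f.
  move=> z; apply: (cont_pair _ _ _ (fun z : 'rV[R]_N * R => half_proj z.1) snd).
    by apply: continuous_comp; [exact: cvg_fst|exact: continuous_half_proj].
  exact: cvg_snd.
have fA z : (half_space_cl hN `*` setT) (f z) by split => //; exact: half_proj_cl.
have -> : uncurry (fun x t => u (half_proj x) t) = uncurry u \o f.
  by apply/funext => -[].
move=> z S /(cu (f z) (fA z)) HS.
have H := fc z _ HS.
by apply: (@filterS _ (nbhs z) _ _ _ _ H) => w /(_ (fA w)).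
Qed.

(** A half cube containing the half ball of radius [p], see [box_sqn]; the lower end 0 in the first
    coordinate keeps it in the closed half-space. *)
Definition box (p : R) : set 'rV[R]_N :=
  [set x | forall k, `[if k == i0 then 0 else - p, p]%classic (x 0 k)].

Lemma compact_box (p : R) : compact (box p).
Proof.
exact: (@rV_compact R N (fun k => `[if k == i0 then 0 else - p, p]%classic)
  (fun k => @segment_compact _ _ _)).
Qed.

Lemma box_sqn (p : R) (x : 'rV[R]_N) : 0 <= p -> 0 <= x 0 i0 ->
  sqn R N x <= p ^+ 2 -> box p x.
Proof.
move=> p0 x0 xp k /=; rewrite in_itv/=.
have : x 0 k ^+ 2 <= p ^+ 2 by apply: le_trans xp; exact: sqr_coord_le_sqn.
rewrite -[p ^+ 2]real_normK ?num_real// -[x 0 k ^+ 2]real_normK ?num_real//.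
rewrite ler_pXn2r ?nnegrE// (ger0_norm p0) ler_norml => /andP[x1 x2].
by rewrite x2 andbT; case: eqP => // ->.
Qed.

End HalfSpaceTopology.

(** * Time derivatives of the factors, and the algebra that rules out a contact *)

Lemma is_derive_shift (R : realType) (t0 q t : R) :
  is_derive t 1 (fun s => s - t0 + q) 1.
Proof.
have := is_deriveD (is_deriveB (is_derive_id t (1 : R)) (is_derive_cst t0 t 1))
  (is_derive_cst q t 1).
by rewrite subr0 addr0.
Qed.

Lemma is_derive_shift_inv (R : realType) (t0 q t : R) : t - t0 + q != 0 ->
  is_derive t 1 (fun s => (s - t0 + q)^-1) (- (t - t0 + q)^-1 ^+ 2).
Proof.
move=> n0; have d := is_derive_shift R t0 q t.
have dV := @is_deriveV R (fun s => s - t0 + q) t 1 1 n0 d.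
by apply: is_derive_eq dV _; rewrite [_ *: 1]mulr1 exprVn.
Qed.

Lemma is_derive_expR_comp (R : realType) (f : R -> R) (t f1 : R) :
  is_derive t 1 f f1 -> is_derive t 1 (fun s => expR (f s)) (expR (f t) * f1).
Proof.
move=> d; exact: (is_derive1_comp (is_derive_expR (f t)) d).
Qed.

Lemma is_derive_scale (R : realType) (f : R -> R) (c t f1 : R) :
  is_derive t 1 f f1 -> is_derive t 1 (fun s => c * f s) (c * f1).
Proof. by move=> d; have := is_deriveZ c d; exact. Qed.

(* With [g = C + T] and [G = h (1 + a + h / 2)], the left-hand side of the last
   hypothesis is at least
   [C w (g G - mx) + w G (C^2 + 3 C T + T^2) + eps h T (C + T)
    + eps E ((2 n + 1) Q - 2 n)]. *)
Lemma translation_no_contact (R : realType) (C T h a w mx X eps Q E n : R) :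
  0 <= C -> 0 < T -> 0 < h -> 0 <= a -> 0 <= w -> 0 < eps -> 1 <= Q -> 0 < E ->
  0 <= n -> let g := C + T in let G := h * (1 + a + h / 2) in
  mx <= g * G -> - C * (w * mx + (eps * h * T + eps * Q * E)) <= X ->
  X - w * (G * T ^+ 2) + (- eps * h * T ^+ 2 + (2 * n + C + 1) * eps * Q * E)
    + (g * h) ^+ 2 * w - 2 * (g * h) * (- g * (1 + a) * w - eps * T)
    - 2 * n * (eps * E) <= 0 -> False.
Proof.
move=> C0 T0 h0 a0 w0 eps0 Q1 E0 n0 g G mxG HX.
have G0 : 0 <= G by rewrite mulr_ge0//; lra.
set Y := (Z in X - Z) => le0.
have p1 : 0 <= C * w * (g * G - mx).
  by apply: mulr_ge0; [exact: mulr_ge0|lra].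
have p2 : 0 <= w * G * (C ^+ 2 + 3 * (C * T) + T ^+ 2).
  apply: mulr_ge0; first exact: mulr_ge0.
  have CT : 0 <= C * T by apply: mulr_ge0 => //; lra.
  by move: (sqr_ge0 C) (sqr_ge0 T) => *; lra.
have p3 : 0 <= eps * h * T * (C + T) by rewrite !mulr_ge0//; lra.
have p4 : 0 < eps * E * ((2 * n + 1) * Q - 2 * n).
  have nQ : 0 <= n * (Q - 1) by apply: mulr_ge0 => //; lra.
  by apply: mulr_gt0; [exact: mulr_gt0|lra].
suff : - C * (w * mx + (eps * h * T + eps * Q * E)) - Y
    + (- eps * h * T ^+ 2 + (2 * n + C + 1) * eps * Q * E)
    + (g * h) ^+ 2 * w - 2 * (g * h) * (- g * (1 + a) * w - eps * T)
    - 2 * n * (eps * E) =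
    C * w * (g * G - mx) + w * G * (C ^+ 2 + 3 * (C * T) + T ^+ 2)
    + eps * h * T * (C + T) + eps * E * ((2 * n + 1) * Q - 2 * n).
  by clearbody Y G g; lra.
by rewrite /Y /g /G; field.
Qed.

(** The positive penalty makes the contact strict, [v < k * u]. With [c = k] this excludes boundary
    points, where [u = 0]; with [c = 1] it excludes coinciding points; with [c = 1 - eta] it bounds
    the factor from below. *)
Lemma contact_factor (R : realType) (v k u P c : R) : 0 < P -> 0 <= u ->
  v - k * u + P = 0 -> c * u <= v -> c < k.
Proof.
move=> P0 u0 E cu; rewrite ltNge; apply/negP => kc.
by have := ler_wpM2r u0 kc; lra.
Qed.

Lemma contact_le (R : realType) (v k u P : R) : 0 < P -> v - k * u + P = 0 ->
  v <= k * u.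
Proof. by lra. Qed.

(** Derives minimality at the contact from nonnegativity elsewhere; [c] is the part of the penalty
    that the displacement leaves fixed. *)
Lemma contact_compare (R : realType) (v k u P v' k' u' P' c : R) :
  v - k * u + (c + P) = 0 -> 0 <= v' - k' * u' + (c + P') ->
  v - k * u + P <= v' - k' * u' + P'.
Proof. by lra. Qed.

Lemma defect_le (R : realType) (k eta : R) : 0 <= k -> 0 <= eta -> 1 - eta < k ->
  k * Num.max (1 - k) 0 <= eta.
Proof.
move=> k0 eta0 ke; have [k1|k1] := leP (1 - k) 0; first by rewrite mulr0.
have : k * (1 - k) <= 1 * (1 - k) by apply: ler_wpM2r; lra.
by lra.
Qed.

Lemma ratio_bound (R : realType) (X k : R) : 0 < X -> X <= 1 / 16 ->
  15 / 16 <= k -> X = X / k * k /\ 0 <= X / k <= 1 / 8.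
Proof.
move=> X0 X1 k0; have k1 : 0 < k by lra.
split; first by rewrite divfK// gt_eqF.
apply/andP; split; first by apply: divr_ge0; exact: ltW.
by rewrite ler_pdivrMr//; lra.
Qed.

(** The first order condition eliminates [Da]. In units of [be ^+ 2 * X * ua] the balance is 1 from
    the second derivative of the factor, -1/2 from its time derivative, and at worst -1/4 from
    [Y <= 1 / 8] and -1/4 from [8 * K <= be]. The terms in [C * eta] cancel too, and the strictly
    positive penalty decides. *)
Lemma reflection_no_contact (R : realType)
    (C K be X Y k ua ub Da Db eta eps E b0 Q n F : R) :
  0 <= C -> 0 < be -> 8 * K <= be -> 0 <= K -> 0 <= X -> X = Y * k ->
  0 <= Y <= 1 / 8 -> 0 <= ua -> ub <= k * ua -> 0 < eps -> 0 < E -> 0 <= b0 ->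
  1 <= Q -> 0 <= n -> - K * ub <= Db ->
  -1 * Db + be * X * ua - k * Da + 2 * (eps * E) * -1 * b0 = 0 ->
  - C * (eta * ua + eps * Q * E) <= F ->
  F - (be ^+ 2 / 2 * X - C * eta) * ua + eps * Q * (E * ((2 * n + C + 1) * 1))
    + be ^+ 2 * X * ua - 2 * be * X * Da - 2 * n * (eps * E) <= 0 -> False.
Proof.
move=> C0 be0 Kbe K0 X0 XY /andP[Y0 Y8] ua0 ub_le eps0 E0 b00 Q1 n0 HDb first HF.
have e1 : X * Da = Y * (be * X * ua - Db - 2 * (eps * E) * b0).
  have -> : be * X * ua - Db - 2 * (eps * E) * b0 = k * Da by lra.
  by rewrite XY mulrA.
have q1 : Y * (- K * ub) <= Y * Db by rewrite ler_wpM2l.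
have q2 : Y * (K * ub) <= X * (K * ua).
  have -> : X * (K * ua) = Y * (K * (k * ua)) by rewrite XY; ring.
  by apply: ler_wpM2l => //; apply: ler_wpM2l.
have q3 : 0 <= Y * (eps * E * b0).
  by apply: mulr_ge0 => //; apply: mulr_ge0 => //; apply: ltW; exact: mulr_gt0.
have q4 : X * ua * (8 * K) * be <= X * ua * be * be.
  have -> : X * ua * (8 * K) * be = X * ua * be * (8 * K) by ring.
  by apply: ler_wpM2l => //; apply: mulr_ge0; [exact: mulr_ge0|exact: ltW].
have q5 : X * ua * be ^+ 2 * Y <= X * ua * be ^+ 2 * (1 / 8).
  by apply: ler_wpM2l => //; apply: mulr_ge0; [exact: mulr_ge0|exact: sqr_ge0].
have q6 : 0 <= X * ua * be ^+ 2.
  by apply: mulr_ge0; [exact: mulr_ge0|exact: sqr_ge0].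
have q7 : 0 < eps * E * ((2 * n + 1) * Q - 2 * n).
  have nQ : 0 <= n * (Q - 1) by apply: mulr_ge0 => //; lra.
  by apply: mulr_gt0; [exact: mulr_gt0|lra].
have -> : 2 * be * X * Da = 2 * be * (X * Da) by ring.
rewrite e1 => main.
have q1' : 2 * be * (Y * (- K * ub)) <= 2 * be * (Y * Db).
  by apply: ler_wpM2l => //; lra.
have q2' : 2 * be * (Y * (K * ub)) <= 2 * be * (X * (K * ua)).
  by apply: ler_wpM2l => //; lra.
have q3' : 0 <= 2 * be * (Y * (eps * E * b0)).
  by apply: mulr_ge0 => //; lra.
lra.
Qed.

(** * Bounded solutions *)

Section Solution.
Context {R : realType} {N m : nat} (hN : (1 <= N)%N).
Let i0 := Ordinal hN.
Let e1 : 'rV[R]_N := delta_mx 0 i0.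
Context (r : R) (B : 'M[R]_m) (U : 'I_m -> 'rV[R]_N -> R -> R) (M C : R).
Context (solU : classical_solution hN r B U) (M0 : 0 <= M) (C0 : 0 <= C).
Context (U_bound : forall i (x : 'rV[R]_N) t, 0 <= x 0 i0 -> 0 <= U i x t <= M).
Context (compareC : forall i (V W : 'I_m -> R) (k d : R),
  (forall j, 0 <= V j <= M) -> (forall j, 0 <= W j <= M) ->
  0 <= k -> 0 <= d <= 2 * M -> (forall j, k * V j <= W j + d) ->
  k * reaction R m r B i V - C * (k * Num.max (1 - k) 0 * V i + d)
    <= reaction R m r B i W).

(** Stands in for [U i], whose values outside the closed half-space are arbitrary. *)
Let ext i (x : 'rV[R]_N) t := U i (half_proj hN x) t.

Lemma ext_id i (x : 'rV[R]_N) t : 0 <= x 0 i0 -> ext i x t = U i x t.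
Proof. by move=> x0; rewrite /ext half_proj_id. Qed.

Lemma continuous_ext i : continuous (uncurry (ext i)).
Proof. exact: continuous_extension hN (U i) (@sol_cont _ _ _ _ _ _ _ solU i). Qed.

Lemma cont_ext (T : topologicalType) i (f : T -> 'rV[R]_N) (g : T -> R) z :
  {for z, continuous f} -> {for z, continuous g} ->
  {for z, continuous (fun z => ext i (f z) (g z))}.
Proof.
move=> cf cg.
apply: (@continuous_comp _ _ _ (fun z => (f z, g z)) (uncurry (ext i))).
  exact: cont_pair.
exact: continuous_ext.
Qed.

(** * Translations and the lower bound on the normal derivative *)

Lemma coord_e1 (x : 'rV[R]_N) h : (x + h *: e1) 0 i0 = x 0 i0 + h.
Proof. by rewrite coord_shift eqxx mulr1. Qed.

(** Expanding the square of [x + h e_1] leaves only nonnegative terms, because [x_1] and [h] are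
    nonnegative; so the penalty at the translated point controls [x] and [h] separately. *)
Lemma translation_box (eps h : R) (x : 'rV[R]_N) : 0 < eps -> 0 <= x 0 i0 ->
  0 <= h -> eps * sqn R N (x + h *: e1) <= M ->
  box hN (M / eps + 1) x /\ h \in `[0, M / eps + 1].
Proof.
move=> eps0 x0 h0 le; set q := M / eps.
have q0 : 0 <= q by rewrite divr_ge0// ltW.
have bq : sqn R N (x + h *: e1) <= q by rewrite ler_pdivlMr// mulrC.
have qq : q <= (q + 1) ^+ 2 by rewrite sqrrD; nra.
rewrite sqn_shift -/i0 in bq.
have xh : 0 <= x 0 i0 * h by rewrite mulr_ge0.
have s0 := sqn_ge0 R N x.
split.
  by apply: box_sqn => //; [lra|move: (sqr_ge0 h) => *; lra].
rewrite in_itv/= h0/= -(@ler_pXn2r _ 2) ?nnegrE//; last by lra.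
by lra.
Qed.

(* Stands in for a Lipschitz bound at time [t0], for the barrier [eps h / tau]
   started at [tau = eps / S]. *)
Lemma initial_slope (t0 eps : R) : 0 < eps -> exists2 S : R, 0 < S &
  forall i (x : 'rV[R]_N) h, 0 <= x 0 i0 -> 0 <= h ->
    0 < U i (x + h *: e1) t0 - U i x t0 + S * h
        + eps * (1 + sqn R N (x + h *: e1)).
Proof.
move=> eps0; pose p := M / eps + 1.
have one i : exists S : R, 0 < S /\ forall (x : 'rV[R]_N) h, 0 <= x 0 i0 -> 0 <= h ->
    0 < U i (x + h *: e1) t0 - U i x t0 + S * h
        + eps * (1 + sqn R N (x + h *: e1)).
  pose F (z : 'rV[R]_N * R) := ext i (z.1 + z.2 *: e1) t0 - ext i z.1 t0
    + eps * (1 + sqn R N (z.1 + z.2 *: e1)).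
  have cF : continuous F.
    move=> z; have c1 : {for z, continuous (fun z : 'rV[R]_N * R => z.1 + z.2 *: e1)}.
      by apply: (cont_shift N fst snd); [exact: cvg_fst|exact: cvg_snd].
    suff : {for z, continuous (fun z : 'rV[R]_N * R => ext i (z.1 + z.2 *: e1) t0
      - ext i z.1 t0 + eps * (1 + sqn R N (z.1 + z.2 *: e1)))} by exact.
    apply: cont_add; first apply: cont_sub.
    - by apply: cont_ext => //; exact: cont_cst.
    - by apply: cont_ext; [exact: cvg_fst|exact: cont_cst].
    - apply: cont_mul; first exact: cont_cst.
      apply: cont_add; first exact: cont_cst.
      apply: (@continuous_comp _ _ _ _ (sqn R N)) => //; exact: continuous_sqn.
  have FE (x : 'rV[R]_N) h : 0 <= x 0 i0 -> 0 <= h -> F (x, h) = U i (x + h *: e1) t0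
      - U i x t0 + eps * (1 + sqn R N (x + h *: e1)).
    by move=> x0 h0; rewrite /F/= !ext_id// coord_e1 addr_ge0.
  (* The pairs where the inequality may fail without the slope term. At [h = 0] the penalty makes
     [F] positive, so the smallest [h] on this compact set is positive. *)
  pose K := (box hN p `*` `[0, p]) `&` F @^-1` [set y | y <= 0].
  have cK : compact K.
    apply: compact_closedI.
      by apply: compact_setX; [exact: compact_box|exact: segment_compact].
    by apply: preimage_closed; [move=> z _; exact: cF|exact: closed_le].
  have inK (x : 'rV[R]_N) h : 0 <= x 0 i0 -> 0 <= h -> F (x, h) <= 0 -> K (x, h).
    move=> x0 h0 Fn; split=> //.
    have := U_bound i (x + h *: e1) t0; rewrite coord_e1 => /(_ (addr_ge0 x0 h0)).
    have := U_bound i x t0 x0 => /andP[_ u1] /andP[u2 _].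
    rewrite FE// in Fn.
    have [|xb hb] := translation_box eps h x eps0 x0 h0; last by split.
    by lra.
  have [K0|Kn] := pselect (K !=set0).
    have [|[y l] yK ymin] := @compact_EVT_min _ R snd K K0 cK.
      by apply: continuous_subspaceT => z; exact: cvg_snd.
    move: yK; rewrite inE => -[[/= yb]]; rewrite in_itv/= => /andP[l0 _] Fyl.
    have y0 : 0 <= y 0 i0.
      by have := yb i0; rewrite /= in_itv/= ?eqxx => /andP[].
    have l1 : 0 < l.
      rewrite lt_neqAle l0 andbT; apply/eqP => l00; move: Fyl.
      rewrite FE// -l00 scale0r addr0 subrr add0r leNgt => /negP; apply.
      by rewrite mulr_gt0// ltr_wpDr// sqn_ge0.
    (* For [h >= l] the term [M / l * h] already reaches the bound [M]; for [h < l] the pair is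
       outside [K]. *)
    exists (M / l + 1); split; first by rewrite ltr_wpDl// divr_ge0.
    move=> x h x0 h0.
    have uu := U_bound i x t0 x0.
    have := U_bound i (x + h *: e1) t0; rewrite coord_e1 => /(_ (addr_ge0 x0 h0)) ub.
    have sn := sqn_ge0 R N (x + h *: e1).
    have esn : 0 <= eps * sqn R N (x + h *: e1) by rewrite mulr_ge0// ltW.
    have Mlh : 0 <= (M / l + 1) * h.
      by rewrite mulr_ge0// addr_ge0// divr_ge0.
    have [lh|hl] := leP l h.
      have : M <= M / l * h.
        by rewrite -mulrA ler_peMr// mulrC ler_pdivlMr// mul1r.
      by move: uu ub => /andP[? ?] /andP[? ?]; lra.
    suff : 0 < F (x, h) by rewrite FE//; lra.
    rewrite ltNge; apply/negP => Fn; have := inK x h x0 h0 Fn => Kxh.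
    have : l <= h by apply: (ymin (x, h)); rewrite inE.
    by lra.
  exists 1; split=> // x h x0 h0; suff : 0 < F (x, h) by rewrite FE//; lra.
  by rewrite ltNge; apply/negP => /(inK x h x0 h0) ?; apply: Kn; exists (x, h).
have [S HS] := choice one.
have S0 i : 0 <= S i by have [/ltW] := HS i.
exists (1 + \sum_i S i); first by rewrite ltr_wpDr// sumr_ge0.
move=> i x h x0 h0; have [_ /(_ x h x0 h0)] := HS i.
have : S i * h <= (1 + \sum_i S i) * h.
  rewrite ler_wpM2r// (bigD1 i)//= addrCA lerDl addr_ge0//.
  by apply: sumr_ge0.
by lra.
Qed.

Let v_bound i (x : 'rV[R]_N) t : 0 <= x 0 i0 -> 0 <= ext i x t <= M.
Proof. by move=> x0; rewrite ext_id //; exact: U_bound. Qed.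

Lemma equation i (x : 'rV[R]_N) t : 0 < x 0 i0 ->
  dt (U i) x t - laplacian (U i) x t = reaction R m r B i (fun j => U j x t).
Proof. by move=> x0; exact: (sol_eq solU). Qed.

Lemma boundary i (x : 'rV[R]_N) t : x 0 i0 = 0 -> U i x t = 0.
Proof. by move=> x0; exact: (sol_bd solU). Qed.

(** At a contact the penalty equals [k * U j a s - U j b s], hence is at most [2 * M]: it is an
    admissible shift [d] in [compareC]. *)
Lemma reaction_contact j (a b : 'rV[R]_N) (s k P : R) : 0 <= a 0 i0 ->
  0 <= b 0 i0 -> 0 <= k <= 2 -> 0 < P -> U j b s - k * U j a s + P = 0 ->
  (forall i, 0 <= U i b s - k * U i a s + P) ->
  - C * (k * Num.max (1 - k) 0 * U j a s + P) <=
  reaction R m r B j (fun i => U i b s) - k * reaction R m r B j (fun i => U i a s).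
Proof.
move=> a0 b0 /andP[k0 k2] P0 E nn.
have /andP[ua0 uaM] := U_bound j a s a0; have /andP[ub0 _] := U_bound j b s b0.
have ku : k * U j a s <= 2 * M by exact: ler_pM.
have PM : 0 <= P <= 2 * M by apply/andP; split; lra.
have comp i : k * U i a s <= U i b s + P by have := nn i; lra.
have := compareC j (fun i => U i a s) (fun i => U i b s) k P
  (fun i => U_bound i a s a0) (fun i => U_bound i b s b0) k0 PM comp.
by move: (reaction _ _ _ _ _ _) (reaction _ _ _ _ _ _) => *; lra.
Qed.

(** First contact for pairs [(x, h)] over a unit of time. The penalty has two parts: [eps h / tau]
    handles the initial time, and [eps (1 + |b|^2) exp (K tau)] handles infinity. *)
Lemma translation_bound_eps i (x : 'rV[R]_N) h t1 eps : 0 < eps ->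
  0 <= x 0 i0 -> 0 <= h ->
  expR (- (C + 1) * (h * (1 + x 0 i0 + h / 2))) * U i x t1 <=
  U i (x + h *: e1) t1
    + eps * (h + (1 + sqn R N (x + h *: e1)) * expR ((2 * N%:R + C + 1) * 2)).
Proof.
move=> eps0 x00 h00; pose t0 := t1 - 1.
have [S S0 HS] := initial_slope t0 eps eps0.
(* [q <= eps / S] makes [eps h / tau] dominate [S h] at the start, and [q <= 1] keeps [tau <= 2] at
   the end. In [K], [2 N] pays for the Laplacian of the penalty, [C] for the reaction, and 1 gives
   strictness. *)
pose q := Num.min (eps / S) 1; pose K := 2 * N%:R + C + 1.
have q0 : 0 < q by rewrite lt_min ltr01 andbT divr_gt0.
have q1 : q <= 1 by rewrite ge_min lexx orbT.
have qS : S <= eps / q.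
  by rewrite ler_pdivlMr// mulrC -ler_pdivlMr// ge_min lexx.
have K0 : 0 <= K by rewrite /K !addr_ge0// mulr_ge0.
pose tau (s : R) := s - t0 + q.
pose G (z : 'rV[R]_N * R) := z.2 * (1 + z.1 0 i0 + z.2 / 2).
pose k z s := expR (- G z * (C + (tau s)^-1)).
pose b (z : 'rV[R]_N * R) := z.1 + z.2 *: e1.
pose P (z : 'rV[R]_N * R) s :=
  eps * z.2 * (tau s)^-1 + eps * (1 + sqn R N (b z)) * expR (K * tau s).
pose Z j z s := ext j (b z) s - k z s * ext j z.1 s + P z s.
pose A := [set z : 'rV[R]_N * R | 0 <= z.1 0 i0 /\ 0 <= z.2].
pose p := M / eps + 1.
pose D : set ('rV[R]_N * R) := box hN p `*` `[0, p].
have tau_gt0 s : t0 <= s -> 0 < tau s by rewrite /tau; lra.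
have Ab z : A z -> 0 <= b z 0 i0.
  by move=> [/= z1 z2]; rewrite coord_e1 addr_ge0.
have G_ge0 z : A z -> 0 <= G z.
  by move=> [/= z1 z2]; rewrite mulr_ge0//; lra.
have k_le1 z s : A z -> t0 <= s -> 0 <= k z s <= 1.
  move=> Az /tau_gt0 s0; rewrite expR_ge0/= expR_le1 mulNr oppr_le0.
  by rewrite mulr_ge0 ?G_ge0// addr_ge0// invr_ge0 ltW.
have P_gt0 z s : A z -> t0 <= s -> 0 < P z s.
  move=> [/= z1 z2] /tau_gt0 s0; rewrite ltr_wpDl//.
    by rewrite !mulr_ge0// ?invr_ge0 ltW.
  by rewrite !mulr_gt0 ?expR_gt0// ltr_wpDr// sqn_ge0.
have shiftA (y : 'rV[R]_N) (l x' : R) : `|x'| < y 0 i0 -> 0 <= l ->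
    A (y + x' *: e1, l).
  by rewrite ltr_norml => /andP[x1 x2] l0; split => //=; rewrite coord_e1; lra.
(* Sliding moves [x] by [x'] and [h] by [- x'], so that the point [b] stays fixed. *)
have slideA (y : 'rV[R]_N) (l x' : R) : `|x'| <= Num.min (y 0 i0) l / 2 ->
    0 < y 0 i0 -> 0 < l -> A (y + x' *: e1, l - x').
  rewrite ler_norml => /andP[x1 x2] y0 l0.
  have da : Num.min (y 0 i0) l <= y 0 i0 by rewrite ge_min lexx.
  have dl : Num.min (y 0 i0) l <= l by rewrite ge_min lexx orbT.
  by split => /=; rewrite ?coord_e1; lra.
(* Along a slide the exponent changes quadratically; the linear coefficient [g * (1 + a)] reappears
   in [slope]. *)
have slideE (y : 'rV[R]_N) (l x' a g : R) :
    - ((l - x') * (1 + (a + x') + (l - x') / 2)) * g =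
    - (l * (1 + a + l / 2)) * g + (g * (1 + a) * x' + g / 2 * x' ^+ 2).
  by field.
have shiftE (l a x' g : R) : - (l * (1 + (a + x') + l / 2)) * g =
    - (l * (1 + a + l / 2)) * g + - (g * l) * x' by ring.
have pos : forall j z s, A z -> t0 <= s <= t1 -> 0 < Z j z s.
  apply: (first_contact R _ m Z A D).
  - by apply: compact_setX; [exact: compact_box|exact: segment_compact].
  - move=> z [zb]; rewrite /= in_itv/= => /andP[z2 _]; split=> //.
    by have := zb i0; rewrite /= in_itv/= ?eqxx => /andP[].
  - move=> j z s /andP[s0 _].
    have c2 : {for (z, s), continuous (@snd ('rV[R]_N * R)%type R)}.
      exact: cvg_snd.
    have c11 : {for (z, s), continuous (fun y : ('rV[R]_N * R) * R => y.1.1)}.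
      by apply: (@continuous_comp _ _ _ fst fst); exact: cvg_fst.
    have c12 : {for (z, s), continuous (fun y : ('rV[R]_N * R) * R => y.1.2)}.
      by apply: (@continuous_comp _ _ _ fst snd); [exact: cvg_fst|exact: cvg_snd].
    have cb : {for (z, s), continuous (fun y : ('rV[R]_N * R) * R => b y.1)}.
      exact: cont_shift.
    have ct : {for (z, s), continuous (fun y : ('rV[R]_N * R) * R => (tau y.2)^-1)}.
      apply: cont_inv; last by rewrite gt_eqF// tau_gt0.
      by apply: cont_add; [apply: cont_sub => //|]; exact: cont_cst.
    have ct' : {for (z, s), continuous (fun y : ('rV[R]_N * R) * R => tau y.2)}.
      by apply: cont_add; [apply: cont_sub => //|]; exact: cont_cst.
    have cx : {for (z, s), continuous (fun y : ('rV[R]_N * R) * R => y.1.1 0 i0)}.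
      apply: (@continuous_comp _ _ _ (fun y : ('rV[R]_N * R) * R => y.1.1)
        (fun x : 'rV[R]_N => x 0 i0)) => //; exact: continuous_coord.
    have -> : uncurry (Z j) = (fun y : ('rV[R]_N * R) * R =>
        ext j (b y.1) y.2 - expR (- (y.1.2 * (1 + y.1.1 0 i0 + y.1.2 / 2))
          * (C + (tau y.2)^-1)) * ext j y.1.1 y.2
        + (eps * y.1.2 * (tau y.2)^-1
          + eps * (1 + sqn R N (b y.1)) * expR (K * tau y.2))).
      by apply/funext => -[].
    apply: cont_add; first apply: cont_sub.
    + exact: cont_ext.
    + apply: cont_mul; last exact: cont_ext.
      apply: cont_expR; apply: cont_mul; last first.
        by apply: cont_add => //; exact: cont_cst.
      apply: cont_opp; apply: cont_mul => //; apply: cont_add; last first.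
        by apply: cont_mul => //; exact: cont_cst.
      by apply: cont_add => //; exact: cont_cst.
    + apply: cont_add.
        by apply: cont_mul => //; apply: cont_mul => //; exact: cont_cst.
      apply: cont_mul.
        apply: cont_mul; first exact: cont_cst.
        apply: cont_add; first exact: cont_cst.
        apply: (@continuous_comp _ _ _ _ (sqn R N)) => //; exact: continuous_sqn.
      by apply: cont_expR; apply: cont_mul => //; exact: cont_cst.
  (* Confinement: where the two-point function is nonpositive, the penalty is at most
     [k * u <= M]. *)
  - move=> j [y l] s Az /andP[s0 s1] Zn.
    have [y0 l0] := Az; rewrite /= in y0 l0.
    have := v_bound j (b (y, l)) s (Ab _ Az) => /andP[u1 _].
    have := v_bound j y s y0 => /andP[u2 u3].
    have /andP[k0 k1] := k_le1 _ _ Az s0.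
    have ku : k (y, l) s * ext j y s <= M by rewrite -[M]mul1r ler_pM.
    have [|xb hb] := translation_box eps l y eps0 y0 l0; last by split.
    move: Zn; rewrite /Z /P/=.
    have e0 : 1 <= expR (K * tau s).
      by rewrite -[X in X <= _]expR0 ler_expR mulr_ge0// ltW// tau_gt0.
    have sn := sqn_ge0 R N (b (y, l)).
    have : eps * (1 + sqn R N (b (y, l))) <=
        eps * (1 + sqn R N (b (y, l))) * expR (K * tau s).
      by rewrite ler_peMr// mulr_ge0//; [exact: ltW|exact: addr_ge0].
    have : 0 <= eps * l * (tau s)^-1.
      apply: mulr_ge0; first by apply: mulr_ge0 => //; exact: ltW.
      by rewrite invr_ge0 ltW// tau_gt0.
    rewrite mulrDr mulr1 /b/=; lra.
  - move=> j [y l] Az; have [/= y0 l0] := Az; rewrite /Z /P/=.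
    have /andP[k0 k1] := k_le1 _ _ Az (lexx t0).
    rewrite !ext_id//; last exact: (Ab _ Az).
    have := HS j y l y0 l0; rewrite -/(b (y, l)).
    have /andP[u2 u3] := U_bound j y t0 y0.
    have : k (y, l) t0 * U j y t0 <= U j y t0 by rewrite ler_piMl.
    have : S * l <= eps * l * (tau t0)^-1.
      by rewrite mulrAC ler_wpM2r// /tau subrr add0r.
    have e0 : 1 <= expR (K * tau t0).
      by rewrite -[X in X <= _]expR0 ler_expR mulr_ge0// ltW// tau_gt0.
    have sn := sqn_ge0 R N (b (y, l)).
    have : eps * (1 + sqn R N (b (y, l))) <=
        eps * (1 + sqn R N (b (y, l))) * expR (K * tau t0).
      by rewrite ler_peMr// mulr_ge0//; [exact: ltW|exact: addr_ge0].
    lra.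
  - move=> j [y l] s [yb]; rewrite /= in_itv/= => /andP[l0 _] t0s st1 Zs nn past.
    have y0 : 0 <= y 0 i0.
      by have := yb i0; rewrite /= in_itv/= ?eqxx => /andP[].
    have Ay : A (y, l) by [].
    have tau0 : 0 < tau s by apply: tau_gt0; exact: ltW.
    have Ps := P_gt0 _ _ Ay (ltW t0s).
    have bb0 := Ab _ Ay.
    have ZE j' s' : Z j' (y, l) s' =
        U j' (b (y, l)) s' - k (y, l) s' * U j' y s' + P (y, l) s'.
      by rewrite /Z !ext_id.
    rewrite ZE in Zs.
    have /andP[ua0 uaM] := U_bound j y s y0.
    have /andP[ub0 ubM] := U_bound j (b (y, l)) s bb0.
    have y1 : 0 < y 0 i0.
      rewrite lt_neqAle y0 andbT; apply/eqP => y00.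
      have uy : U j y s = 0 by exact: boundary.
      have := contact_factor R _ _ _ _ (k (y, l) s) Ps ua0 Zs.
      by rewrite uy mulr0 ltxx => /(_ ub0).
    (* For [l = 0] the two points coincide and the factor is 1. *)
    have l1 : 0 < l.
      rewrite lt_neqAle l0 andbT; apply/eqP => l00.
      have := contact_factor R _ _ _ _ 1 Ps ua0 Zs; rewrite -l00.
      have -> : b (y, 0) = y by rewrite /b/= scale0r addr0.
      have -> : k (y, 0) s = 1 by rewrite /k /G/= mul0r oppr0 mul0r expR0.
      by rewrite mul1r ltxx => /(_ (lexx _)).
    pose T := (tau s)^-1; pose g := C + T; pose kk := k (y, l) s.
    pose E := expR (K * tau s).
    have T0 : 0 < T by rewrite invr_gt0.
    have /andP[kk0 kk1] : 0 <= kk <= 1 by apply: k_le1 => //; exact: ltW.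
    have shift_nn j' (z : 'rV[R]_N * R) : A z ->
        0 <= U j' (b z) s - k z s * U j' z.1 s + P z s.
      by move=> Az; have [z1 z2] := Az; have := nn j' z Az; rewrite /Z !ext_id// Ab.
    have dk : is_derive s 1 (k (y, l)) (kk * (G (y, l) * T ^+ 2)).
      have d1 := is_deriveD (is_derive_cst C s (1 : R))
        (is_derive_shift_inv R t0 q s (lt0r_neq0 tau0)).
      have := is_derive_expR_comp _ _ _ _ (is_derive_scale _ _ (- G (y, l)) _ _ d1).
      by move=> d2; apply: is_derive_eq d2 _; rewrite add0r mulrNN.
    have dP : is_derive s 1 (P (y, l)) (eps * l * (- T ^+ 2)
        + eps * (1 + sqn R N (b (y, l))) * (E * (K * 1))).
      apply: is_deriveD.
        exact: is_derive_scale (is_derive_shift_inv R t0 q s (lt0r_neq0 tau0)).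
      apply: is_derive_scale; apply: is_derive_expR_comp; apply: is_derive_scale.
      exact: is_derive_shift.
    have PE (z : 'rV[R]_N) : P (z, l) s =
        eps * l * T + eps * E + eps * E * sqn R N (b (z, l)).
      by rewrite /P/= -/T -/E; ring.
    have Zs' : U j (b (y, l)) s - (0 + kk) * U j y s + (eps * l * T + eps * E
        + eps * E * sqn R N (b (y, l))) = 0 by rewrite -PE add0r.
    (* Both points are translated together with [l] fixed; the exponent is affine in the first
       coordinate, with rate [g * l]. *)
    have min0 (x' : R) : `|x'| < y 0 i0 ->
      U j (b (y, l)) s - (0 + kk) * U j y s + eps * E * sqn R N (b (y, l)) <=
      U j (b (y, l) + (1 * x') *: delta_mx 0 i0) s
        - (0 + kk * expR (- (g * l) * x')) * U j (y + x' *: delta_mx 0 i0) s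
        + eps * E * sqn R N (b (y, l) + (1 * x') *: delta_mx 0 i0).
      move=> x'y; apply: (contact_compare _ _ _ _ _ _ _ _ _ _ Zs').
      have := shift_nn j _ (shiftA y l x' x'y l0); rewrite PE.
      have -> : b (y + x' *: e1, l) = b (y, l) + (1 * x') *: e1.
        by rewrite mul1r /b/= addrAC.
      have -> : k (y + x' *: e1, l) s = 0 + kk * expR (- (g * l) * x').
        by rewrite add0r /kk /k -expRD /G/= coord_e1 -/T -/g shiftE.
      exact.
    have mink (l' : 'I_N) (x' : R) : l' != i0 ->
      U j (b (y, l)) s - (0 + kk) * U j y s + eps * E * sqn R N (b (y, l)) <=
      U j (b (y, l) + x' *: delta_mx 0 l') s
        - (0 + kk) * U j (y + x' *: delta_mx 0 l') s
        + eps * E * sqn R N (b (y, l) + x' *: delta_mx 0 l').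
      move=> l'i0.
      have yE : (y + x' *: delta_mx 0 l') 0 i0 = y 0 i0.
        by rewrite coord_shift eq_sym (negbTE l'i0) mulr0 addr0.
      have Az : A (y + x' *: delta_mx 0 l', l) by split => //=; rewrite yE.
      apply: (contact_compare _ _ _ _ _ _ _ _ _ _ Zs').
      have := shift_nn j _ Az; rewrite PE.
      have -> : b (y + x' *: delta_mx 0 l', l) = b (y, l) + x' *: delta_mx 0 l'.
        by rewrite /b/= addrAC.
      have -> : k (y + x' *: delta_mx 0 l', l) s = 0 + kk.
        by rewrite add0r /kk /k /G/= yE.
      exact.
    have minT s' : t0 <= s' < s ->
        U j (b (y, l)) s - k (y, l) s * U j y s + P (y, l) s <=
        U j (b (y, l)) s' - k (y, l) s' * U j y s' + P (y, l) s'.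
      by move=> /past/ltW; rewrite ZE Zs.
    have yb0 : y 0 i0 <= b (y, l) 0 i0 by rewrite coord_e1/= lerDl.
    pose a := y 0 i0; pose Q := 1 + sqn R N (b (y, l)).
    pose w := kk * U j y s; pose D1 := dx i0 (U j) y s.
    pose X := reaction R m r B j (fun i => U i (b (y, l)) s)
      - kk * reaction R m r B j (fun i => U i y s).
    have gT : 0 < g by rewrite ltr_wpDl.
    (* A second first order condition, from sliding [a] with [b] fixed. Since [y] is interior and
       [l > 0], both directions of sliding are allowed, so the derivative vanishes and the slope at
       [a] is known exactly. *)
    have slope : kk * D1 = - g * (1 + a) * w - eps * T.
      pose f (x' : R) := (g * (1 + a)) * x' + (g / 2) * x' ^+ 2.
      pose phi (x' : R) := U j (b (y, l)) s
        - (kk * expR (f x')) * U j (y + x' *: e1) s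
        + ((- eps * T) * x' + 0 * x' ^+ 2).
      have dphi : is_derive (0 : R) 1 phi (- (g * (1 + a) * w) - kk * D1 - eps * T).
        have dU : is_derive (0 : R) 1 (fun x' => U j (y + x' *: e1) s) D1.
          have := is_derive_line R N ((U j)^~ s) y e1 0.
          by rewrite scale0r addr0; apply; exact: (@C21_ex_dx _ _ _ _ (sol_C21 solU j)).
        have df := is_derive_scale R _ kk _ _
          (is_derive_expR_comp R _ _ _ (is_derive_quadratic R (g * (1 + a)) (g / 2) 0)).
        have := is_derive_twopoint R _ _ _ _ 0 _ _ _ _
          (is_derive_cst (U j (b (y, l)) s) (0 : R) (1 : R)) df dU
          (is_derive_quadratic R (- eps * T) 0 0).
        move=> dd; apply: is_derive_eq dd _.
        rewrite !mulr0 !addr0 expr0n/= !mulr0 addr0 expR0 scale0r addr0 /w.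
        by clearbody D1; move: (U j y s) => *; ring.
      pose d := Num.min a l / 2.
      have d0 : 0 < d by rewrite divr_gt0// lt_min y1.
      have phi_min x' : `|x'| <= d -> phi 0 <= phi x'.
        move=> x'd; have Az := slideA y l x' x'd y1 l1.
        have := shift_nn j _ Az.
        have bE : b (y + x' *: e1, l - x') = b (y, l).
          by rewrite /b/= -addrA -scalerDl; congr (_ + _ *: _); ring.
        have -> : k (y + x' *: e1, l - x') s = kk * expR (f x').
          by rewrite /kk /k -expRD /G/= coord_e1 -/a -/T -/g (slideE y).
        have -> : P (y + x' *: e1, l - x') s =
            eps * l * T + eps * Q * E + (- eps * T * x' + 0 * x' ^+ 2).
          by rewrite /P bE /= -/E -/T -/Q; ring.
        rewrite bE => H.
        apply: (contact_compare _ _ _ _ _ _ _ _ _ (eps * l * T + eps * Q * E) _ H).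
        rewrite /f scale0r expr0n/= !(mulr0, addr0, expR0, mulr1).
        exact: Zs.
      have le0 : - (g * (1 + a) * w) - kk * D1 - eps * T <= 0.
        apply: (derive_le0_left R phi 0 (- d) _ _ dphi); first by rewrite oppr_lt0.
        move=> x' /andP[x1 x2]; apply: phi_min; rewrite ler_norml x1/=.
        exact: le_trans (ltW x2) (ltW d0).
      have ge0 : 0 <= - (g * (1 + a) * w) - kk * D1 - eps * T.
        apply: (derive_ge0_right R phi 0 d _ d0 dphi).
        move=> x' /andP[x1 x2]; apply: phi_min; rewrite ler_norml x2 andbT.
        by apply: le_trans (ltW x1); rewrite oppr_le0 ltW.
      by move: le0 ge0; clear; move: (kk * D1) => *; lra.
    have w0 : 0 <= w by exact: mulr_ge0.
    have HX : - C * (w * Num.max (1 - kk) 0 + (eps * l * T + eps * Q * E)) <= X.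
      have k2 : 0 <= kk <= 2 by rewrite kk0 (le_trans kk1)// ler1n.
      have := reaction_contact j y (b (y, l)) s kk (P (y, l) s) y0 bb0 k2 Ps Zs
        (fun i' => shift_nn i' _ Ay).
      by rewrite /w [kk * U j y s * _]mulrAC; exact.
    (* The factor is the exponential of [- (g * G)], and [expR z >= 1 + z]. *)
    have mxG : Num.max (1 - kk) 0 <= g * G (y, l).
      rewrite ge_max; apply/andP; split; last by rewrite mulr_ge0 ?G_ge0// ltW.
      have : 1 + - G (y, l) * g <= kk by exact: expR_ge1Dx.
      by move: (G (y, l)) => *; lra.
    have Q1 : 1 <= Q by rewrite lerDl sqn_ge0.
    have [_ main] := contact_inequality hN (U j) y (b (y, l)) t0 s 1 0 kk (g * l)
      (eps * E) (y 0 i0) (k (y, l)) (P (y, l)) _ _ (sol_C21 solU j) y1 (lexx _)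
      yb0 (expr1n _ _) min0 mink dk dP (esym (add0r _)) t0s minT.
    apply: (translation_no_contact R C T l a w (Num.max (1 - kk) 0) X eps Q E N%:R
      C0 T0 l1 y0 w0 eps0 Q1 (expR_gt0 _) (ler0n _ _) mxG HX).
    move: main; rewrite !equation -/X -/D1 //; last exact: lt_le_trans yb0.
    have -> : 2 * (g * l) * kk * D1 = 2 * (g * l) * (kk * D1) by ring.
    rewrite slope add0r -/X /w /Q /K; clear.
    rewrite -[G (y, l)]/(l * (1 + a + l / 2)).
    rewrite /g; clearbody kk E T a.
    move: (U j y s) (sqn R N (b (y, l))) X N%:R => u sq Y n; lra.
have xA : A (x, h) by [].
have := pos i (x, h) t1 xA ltac:(rewrite /t0; apply/andP; split; lra).
rewrite /Z /P/= !ext_id//; last exact: (Ab _ xA).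
have tau1 : tau t1 = 1 + q by rewrite /tau /t0; ring.
(* At [t1] the elapsed time is at least 1, so [C + 1] can replace [C + 1 / tau] in the exponent. *)
have iq : (1 + q)^-1 <= 1 by rewrite invf_le1; lra.
have /andP[u0 _] := U_bound i x t1 x00.
have k_ge : expR (- (C + 1) * (h * (1 + x 0 i0 + h / 2))) <= k (x, h) t1.
  rewrite ler_expR tau1 !mulNr lerN2 mulrC ler_wpM2r ?(G_ge0 _ xA)//.
  by rewrite lerD2l.
have ku := ler_wpM2r u0 k_ge.
have p1 : eps * h * (tau t1)^-1 <= eps * h.
  by rewrite tau1 ler_piMr// mulr_ge0// ltW.
have p2 : eps * (1 + sqn R N (b (x, h))) * expR (K * tau t1) <=
    eps * ((1 + sqn R N (b (x, h))) * expR (K * 2)).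
  rewrite -mulrA ler_wpM2l ?(ltW eps0)// ler_wpM2l ?addr_ge0 ?sqn_ge0//.
  by rewrite ler_expR ler_wpM2l// tau1; lra.
move: ku p1 p2; rewrite -/K /b/=.
move: (U i (x + h *: e1) t1) (U i x t1) => *; lra.
Qed.

(** The error in the penalised bound is [eps] times a quantity free of [eps]. *)
Lemma translation_bound i (x : 'rV[R]_N) h t : 0 <= x 0 i0 -> 0 <= h ->
  expR (- (C + 1) * (h * (1 + x 0 i0 + h / 2))) * U i x t <= U i (x + h *: e1) t.
Proof.
move=> x0 h0; apply/ler_addgt0Pr => e e0.
set c := h + (1 + sqn R N (x + h *: e1)) * expR ((2 * N%:R + C + 1) * 2).
have c0 : 0 <= c by rewrite addr_ge0// mulr_ge0 ?expR_ge0// addr_ge0// sqn_ge0.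
have ec : 0 < e / (c + 1) by rewrite divr_gt0// ltr_wpDl.
apply: le_trans (translation_bound_eps i x h t _ ec x0 h0) _.
by rewrite lerD2l -/c -mulrA ler_piMr ?(ltW e0)// mulrC ler_pdivrMr; lra.
Qed.

(** [translation_bound] is an equality at [h = 0]; comparing right derivatives there gives the
    claim. *)
Lemma dx1_lower_bound i (x : 'rV[R]_N) t : 0 < x 0 i0 ->
  - ((C + 1) * (1 + x 0 i0)) * U i x t <= dx i0 (U i) x t.
Proof.
move=> x0; pose a := x 0 i0.
have dU : is_derive (0 : R) 1 (fun h => U i (x + h *: e1) t) (dx i0 (U i) x t).
  have := is_derive_line R N ((U i)^~ t) x e1 0.
  by rewrite scale0r addr0; apply; exact: (@C21_ex_dx _ _ _ _ (sol_C21 solU i)).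
pose f (h : R) := (- (C + 1) * (1 + a)) * h + (- (C + 1) / 2) * h ^+ 2.
pose phi (h : R) := U i (x + h *: e1) t - expR (f h) * U i x t + 0.
have dphi : is_derive (0 : R) 1 phi (dx i0 (U i) x t + (C + 1) * (1 + a) * U i x t).
  have dk := is_derive_expR_comp R _ _ _
    (is_derive_quadratic R (- (C + 1) * (1 + a)) (- (C + 1) / 2) 0).
  have := is_derive_twopoint R _ _ _ _ 0 _ _ _ _ dU dk
    (is_derive_cst (U i x t) (0 : R) (1 : R)) (is_derive_cst (0 : R) (0 : R) (1 : R)).
  move=> dd; apply: is_derive_eq dd _.
  rewrite expr0n/= !(mulr0, addr0, expR0, scale0r).
  by move: (dx _ _ _ _) (U i x t) => *; ring.
have : 0 <= dx i0 (U i) x t + (C + 1) * (1 + a) * U i x t.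
  apply: (derive_ge0_right R phi 0 1 _ ltr01 dphi) => h /andP[h0 _].
  rewrite /phi /f expr0n/= !(mulr0, addr0, expR0, scale0r, mul1r, subrr) subr_ge0.
  have := translation_bound i x h t (ltW x0) (ltW h0).
  by congr (expR _ * _ <= _); rewrite -/a; field.
by rewrite -/a; move: (dx _ _ _ _) (U i x t) => *; lra.
Qed.

(** * Reflections in a plane parallel to the boundary *)

(* With [tau = t - t1 + T], the factor is
   [k = 1 - A + X], [X = mu exp (om tau + be (lam - x_1))] and
   [A = mu exp (om T) - C eta (T - tau)]: [mu_init] makes [k <= 1 - eta] at
   [tau = 0], [mu_eta] makes [k <= 1] on the mirror, and [A = mu exp (om T)] at
   [tau = T] makes [k >= 1] in the end. *)
Section Reflection.
Context (lam K eta be mu T : R).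
Context (lam0 : 0 < lam) (K0 : 0 <= K) (eta0 : 0 <= eta) (eta_half : eta <= 1 / 2).
Context (be0 : 0 < be) (Kbe : 8 * K <= be) (mu0 : 0 < mu) (T0 : 0 < T).
Let om := be ^+ 2 / 2.
Context (slope : forall i (x : 'rV[R]_N) t, lam < x 0 i0 -> x 0 i0 < 2 * lam ->
  - K * U i x t <= dx i0 (U i) x t).
Context (weak : forall i (x : 'rV[R]_N) t, 0 <= x 0 i0 <= lam ->
  (1 - eta) * U i x t <= U i (x + (2 * (lam - x 0 i0)) *: e1) t).
Context (mu_eta : C * eta <= mu * om)
  (mu_init : mu * expR (be * lam) + eta <= mu * expR (om * T) - C * eta * T)
  (mu_small : mu * expR (om * T + be * lam) <= 1 / 16).

Let refl (x : 'rV[R]_N) := x + (2 * (lam - x 0 i0)) *: e1.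

(** First contact in the slab between the boundary and the mirror, over a time [T]. The start is
    covered by [weak], the boundary by the vanishing of the solution, the mirror by a factor at most
    1, and the interior by [reflection_no_contact]. *)
Lemma reflection_bound_eps i (x : 'rV[R]_N) (t1 eps : R) : 0 < eps ->
  0 <= x 0 i0 <= lam ->
  (1 + mu * expR (om * T) * (expR (be * (lam - x 0 i0)) - 1)) * U i x t1 <=
  U i (refl x) t1
    + eps * ((1 + sqn R N (refl x)) * expR ((2 * N%:R + C + 1) * T)).
Proof.
have lam_gt0 := lam0; have T_gt0 := T0; have eta_le := eta_half.
move=> eps0 x0lam; pose t0 := t1 - T.
pose Kp := 2 * N%:R + C + 1.
have Kp0 : 0 <= Kp by rewrite /Kp !addr_ge0// mulr_ge0.
have om0 : 0 < om by rewrite divr_gt0// exprn_gt0.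
pose tau (s : R) := s - t1 + T.
pose X (x : 'rV[R]_N) s := mu * expR (om * tau s + be * (lam - x 0 i0)).
pose A s := mu * expR (om * T) - C * eta * (T - tau s).
pose k (x : 'rV[R]_N) (s : R) : R := 1 - A s + X x s.
pose P (x : 'rV[R]_N) (s : R) : R := eps * (1 + sqn R N (refl x)) * expR (Kp * tau s).
pose Z j (x : 'rV[R]_N) (s : R) : R := ext j (refl x) s - k x s * ext j x s + P x s.
pose D0 := [set x : 'rV[R]_N | 0 <= x 0 i0 /\ x 0 i0 <= lam].
(* The factor may reach 2, so [k * u] is bounded by [2 * M] only; hence half of [eps]. *)
pose p := M / (eps / 2) + 1.
pose D : set 'rV[R]_N := box hN p `&` [set x : 'rV[R]_N | x 0 i0 <= lam].
have reflE (x' : 'rV[R]_N) : refl x' 0 i0 = 2 * lam - x' 0 i0 by rewrite coord_e1; ring.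
have refl0 (x' : 'rV[R]_N) : D0 x' -> 0 <= refl x' 0 i0 by move=> [/= ? ?]; rewrite reflE; lra.
have tauI (s : R) : t0 <= s <= t1 -> 0 <= tau s <= T.
  by rewrite /t0 /tau => /andP[? ?]; apply/andP; split; lra.
have X0 (x' : 'rV[R]_N) (s : R) : 0 < X x' s by rewrite mulr_gt0// expR_gt0.
have X_small (x' : 'rV[R]_N) (s : R) : D0 x' -> t0 <= s <= t1 -> X x' s <= 1 / 16.
  move=> [/= x'0 x'1] /tauI/andP[s0 s1]; apply: le_trans mu_small.
  apply: ler_wpM2l; first exact: ltW.
  by rewrite ler_expR lerD// ler_wpM2l ?(ltW om0) ?(ltW be0)//; lra.
have Ce0 : 0 <= C * eta by exact: mulr_ge0.
have A_small (s : R) : t0 <= s <= t1 -> 0 <= A s <= 1 / 16.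
  move=> /tauI/andP[s0 s1]; have c0 : 0 <= C * eta * (T - tau s).
    by apply: mulr_ge0 => //; lra.
  have c1 : C * eta * (T - tau s) <= C * eta * T by apply: ler_wpM2l => //; lra.
  have c2 : mu * expR (om * T) <= mu * expR (om * T + be * lam).
    apply: ler_wpM2l; first exact: ltW.
    by rewrite ler_expR lerDl mulr_ge0// ltW.
  have c3 : 0 <= mu * expR (be * lam) by rewrite mulr_ge0 ?expR_ge0// ltW.
  move: eta0 mu_init mu_small c0 c1 c2 c3; rewrite /A.
  move: (C * eta * T) (C * eta * (T - tau s)) (mu * expR (om * T))
    (mu * expR (be * lam)) (mu * expR (om * T + be * lam)) => *.
  by apply/andP; split; lra.
(* On the mirror the factor is at most 1: [expR (om T)] exceeds [expR (om tau)] by at least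
   [om (T - tau)], and [mu_eta] lets this pay for the term in [C * eta]. *)
have X_A (x' : 'rV[R]_N) (s : R) : x' 0 i0 = lam -> t0 <= s <= t1 -> X x' s <= A s.
  move=> x'1 /tauI/andP[s0 s1].
  rewrite /X /A x'1 subrr mulr0 addr0.
  have E1 : expR (om * T) = expR (om * tau s) * expR (om * (T - tau s)).
    by rewrite -expRD; congr expR; ring.
  have E2 : 1 + om * (T - tau s) <= expR (om * (T - tau s)) by exact: expR_ge1Dx.
  have E3 : 1 <= expR (om * tau s).
    by rewrite -[X in X <= _]expR0 ler_expR mulr_ge0// ltW.
  have oT : 0 <= om * (T - tau s) by apply: mulr_ge0; [exact: ltW|lra].
  have F1 : expR (om * tau s) * (1 + om * (T - tau s)) <= expR (om * T).
    by rewrite E1 ler_wpM2l// expR_ge0.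
  have F2 : om * (T - tau s) <= expR (om * tau s) * (om * (T - tau s)).
    by rewrite ler_peMl.
  have F3 : mu * (expR (om * tau s) + om * (T - tau s)) <= mu * expR (om * T).
    by apply: ler_wpM2l; [exact: ltW|lra].
  have F4 : C * eta * (T - tau s) <= mu * om * (T - tau s).
    by apply: ler_wpM2r => //; lra.
  lra.
have k_range (x' : 'rV[R]_N) (s : R) : D0 x' -> t0 <= s <= t1 -> 15 / 16 <= k x' s <= 2.
  move=> Dx sI; have /andP[a0 a1] := A_small s sI.
  have x0 := X0 x' s; have x1 := X_small x' s Dx sI.
  by rewrite /k; apply/andP; split; lra.
have P_gt0 (x' : 'rV[R]_N) (s : R) : 0 < P x' s.
  by rewrite !mulr_gt0 ?expR_gt0// ltr_wpDr// sqn_ge0.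
have P_ge (x' : 'rV[R]_N) (s : R) : t0 <= s <= t1 -> eps * (1 + sqn R N (refl x')) <= P x' s.
  move=> /tauI/andP[s0 _]; rewrite ler_peMr//.
    by rewrite mulr_ge0//; [exact: ltW|rewrite addr_ge0// sqn_ge0].
  by rewrite -[X in X <= _]expR0 ler_expR mulr_ge0.
have t01 : t0 <= t1 by rewrite /t0; lra.
have reflI (y : 'rV[R]_N) : y 0 i0 < lam -> lam < refl y 0 i0.
  by move=> y1; rewrite reflE; lra.
have reflI2 (y : 'rV[R]_N) : 0 < y 0 i0 -> refl y 0 i0 < 2 * lam.
  by move=> y0; rewrite reflE; lra.
have shiftD (y : 'rV[R]_N) (x' : R) : `|x'| < Num.min (y 0 i0) (lam - y 0 i0) ->
    D0 (y + x' *: e1).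
  rewrite ltr_norml => /andP[x1 x2].
  have dy : Num.min (y 0 i0) (lam - y 0 i0) <= y 0 i0 by rewrite ge_min lexx.
  have dl : Num.min (y 0 i0) (lam - y 0 i0) <= lam - y 0 i0.
    by rewrite ge_min lexx orbT.
  by split; rewrite /= coord_e1; lra.
have refl_shift (y : 'rV[R]_N) (x' : R) :
    refl (y + x' *: e1) = refl y + (-1 * x') *: e1.
  by rewrite /refl coord_e1 -!addrA -!scalerDl; congr (_ + _ *: _); ring.
have half_eta : 1 / 2 <= 1 - eta by lra.
have num1 : (0 : R) < 15 / 16 by lra.
have pos : forall j x s, D0 x -> t0 <= s <= t1 -> 0 < Z j x s.
  apply: (first_contact R _ m Z D0 D).
  - apply: compact_closedI; first exact: compact_box.
    have cl : closed ((fun x : 'rV[R]_N => x 0 i0) @^-1` [set y | y <= lam]).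
      apply: preimage_closed; last exact: closed_le.
      by move=> z _; exact: continuous_coord.
    exact: cl.
  - move=> z [zb /= z1]; split=> //.
    by have := zb i0; rewrite /= in_itv/= ?eqxx => /andP[].
  - move=> j z s sI.
    have c1 : {for (z, s), continuous (@fst 'rV[R]_N R)} by exact: cvg_fst.
    have c2 : {for (z, s), continuous (@snd 'rV[R]_N R)} by exact: cvg_snd.
    have cx : {for (z, s), continuous (fun y : 'rV[R]_N * R => y.1 0 i0)}.
      by apply: (@continuous_comp _ _ _ fst (fun x : 'rV[R]_N => x 0 i0)) => //;
        exact: continuous_coord.
    have cl : {for (z, s), continuous (fun y : 'rV[R]_N * R => lam - y.1 0 i0)}.
      by apply: cont_sub => //; exact: cont_cst.
    have cr : {for (z, s), continuous (fun y : 'rV[R]_N * R => refl y.1)}.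
      by apply: cont_shift => //; apply: cont_mul => //; exact: cont_cst.
    have ct : {for (z, s), continuous (fun y : 'rV[R]_N * R => tau y.2)}.
      by apply: cont_add; [apply: cont_sub => //|]; exact: cont_cst.
    have -> : uncurry (Z j) = (fun y : 'rV[R]_N * R =>
        ext j (refl y.1) y.2
        - (1 - (mu * expR (om * T) - C * eta * (T - tau y.2))
           + mu * expR (om * tau y.2 + be * (lam - y.1 0 i0))) * ext j y.1 y.2
        + eps * (1 + sqn R N (refl y.1)) * expR (Kp * tau y.2)).
      by apply/funext => -[].
    apply: cont_add; first apply: cont_sub.
    + exact: cont_ext.
    + apply: cont_mul; last exact: cont_ext.
      apply: cont_add.
        apply: cont_sub; first exact: cont_cst.
        apply: cont_sub; first exact: cont_cst.
        apply: cont_mul; first exact: cont_cst.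
        by apply: cont_sub => //; exact: cont_cst.
      apply: cont_mul; first exact: cont_cst.
      apply: cont_expR; apply: cont_add.
        by apply: cont_mul => //; exact: cont_cst.
      by apply: cont_mul => //; exact: cont_cst.
    + apply: cont_mul.
        apply: cont_mul; first exact: cont_cst.
        apply: cont_add; first exact: cont_cst.
        apply: (@continuous_comp _ _ _ _ (sqn R N)) => //; exact: continuous_sqn.
      by apply: cont_expR; apply: cont_mul => //; exact: cont_cst.
  - move=> j y s Dy sI Zn; have [y0 y1] := Dy; rewrite /= in y0 y1.
    have /andP[u1 _] := v_bound j (refl y) s (refl0 _ Dy).
    have /andP[u2 u3] := v_bound j y s y0.
    have /andP[k0 k2] := k_range y s Dy sI.
    have ku : k y s * ext j y s <= 2 * M by apply: ler_pM => //; lra.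
    have Py := P_ge y s sI.
    have h0 : 0 <= 2 * (lam - y 0 i0) by lra.
    have eps2 : 0 < eps / 2 by lra.
    have [|yb _] := translation_box (eps / 2) _ y eps2 y0 h0; last by split.
    move: Zn Py; rewrite /Z -/(refl y); move: (sqn R N (refl y)) (P y s) => sq Py.
    by move: ku u1; move: (ext j (refl y) s) (k y s * _) => *; lra.
  - move=> j y Dy; have [/= y0 y1] := Dy; rewrite /Z.
    rewrite !ext_id//; last exact: refl0.
    have sI : t0 <= t0 <= t1 by rewrite lexx.
    have k1 : k y t0 <= 1 - eta.
      have tau0 : tau t0 = 0 by rewrite /tau /t0; ring.
      have XE : X y t0 <= mu * expR (be * lam).
        rewrite /X tau0 mulr0 add0r; apply: ler_wpM2l; first exact: ltW.
        by rewrite ler_expR ler_wpM2l ?(ltW be0)//; lra.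
      by move: XE mu_init; rewrite /k /A tau0 subr0; lra.
    have /andP[u2 _] := U_bound j y t0 y0.
    have := ler_wpM2r u2 k1.
    have := weak j y t0; rewrite y0 y1 => /(_ isT).
    rewrite -/(refl y); have := P_gt0 y t0.
    move: (P y t0) (U j (refl y) t0) (U j y t0) (k y t0) => *; lra.
  - move=> j y s [yb /= y1'] t0s st1 Zs nn past.
    have sI : t0 <= s <= t1 by rewrite (ltW t0s).
    have y0' : 0 <= y 0 i0.
      by have := yb i0; rewrite /= in_itv/= ?eqxx => /andP[].
    have Dy : D0 y by [].
    have ZE j' (y' : 'rV[R]_N) s' : D0 y' -> Z j' y' s' =
        U j' (refl y') s' - k y' s' * U j' y' s' + P y' s'.
      by move=> Dy'; rewrite /Z !ext_id//; [case: Dy'|exact: refl0].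
    rewrite ZE// in Zs.
    have /andP[ua0 uaM] := U_bound j y s y0'.
    have /andP[ub0 ubM] := U_bound j (refl y) s (refl0 _ Dy).
    have Ps := P_gt0 y s.
    have /andP[kk0 kk2] := k_range y s Dy sI.
    have y0 : 0 < y 0 i0.
      rewrite lt_neqAle y0' andbT; apply/eqP => y00.
      have uy : U j y s = 0 by exact: boundary.
      have := contact_factor R _ _ _ _ (k y s) Ps ua0 Zs.
      by rewrite uy mulr0 ltxx => /(_ ub0).
    have y1 : y 0 i0 < lam.
      rewrite lt_neqAle y1' andbT; apply/eqP => y11.
      have ry : refl y = y by rewrite /refl y11 subrr mulr0 scale0r addr0.
      have := contact_factor R _ _ _ _ 1 Ps ua0 Zs; rewrite ry mul1r lexx.
      move=> /(_ isT); rewrite ltNge => /negP; apply.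
      by rewrite /k -addrA gerDl addrC subr_le0; exact: X_A.
    pose E := expR (Kp * tau s); pose Q := 1 + sqn R N (refl y).
    pose Xs := X y s; pose kk := k y s.
    have dtau : is_derive s 1 tau 1 by exact: is_derive_shift.
    have dk : is_derive s 1 (k y) (om * Xs - C * eta).
      have d1 := is_derive_scale _ _ (C * eta) _ _
        (is_deriveB (is_derive_cst T s (1 : R)) dtau).
      have d2 := is_deriveB (is_derive_cst (1 : R) s (1 : R))
        (is_deriveB (is_derive_cst (mu * expR (om * T)) s (1 : R)) d1).
      have d3 := is_derive_scale _ _ mu _ _ (is_derive_expR_comp _ _ _ _
        (is_deriveD (is_derive_scale _ _ om _ _ dtau)
          (is_derive_cst (be * (lam - y 0 i0)) s (1 : R)))).
      apply: is_derive_eq (is_deriveD d2 d3) _.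
      by rewrite /Xs /X; move: (expR _) => *; ring.
    have dP : is_derive s 1 (P y) (eps * Q * (E * (Kp * 1))).
      exact: (is_derive_scale _ _ _ _ _ (is_derive_expR_comp _ _ _ _
        (is_derive_scale _ _ Kp _ _ dtau))).
    pose d := Num.min (y 0 i0) (lam - y 0 i0).
    have d0 : 0 < d by rewrite lt_min y0 subr_gt0.
    have dy : d <= y 0 i0 by rewrite ge_min lexx.
    have dr : d <= refl y 0 i0.
      by apply: le_trans dy _; exact: ltW (lt_trans y1 (reflI y y1)).
    have kkE : 1 - A s + Xs = kk by [].
    have nnU (y' : 'rV[R]_N) : D0 y' -> 0 <= U j (refl y') s - k y' s * U j y' s + P y' s.
      by move=> Dy'; have := nn j _ Dy'; rewrite ZE.
    have PE (z : 'rV[R]_N) : P z s = eps * E + eps * E * sqn R N (refl z).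
      by rewrite /P -/E; ring.
    have Zs' : U j (refl y) s - (1 - A s + Xs) * U j y s
        + (eps * E + eps * E * sqn R N (refl y)) = 0 by rewrite -PE.
    (* Displacing [y] displaces its mirror image the opposite way, whence the sign -1; only the part
       [Xs] of the factor varies. *)
    have min0 (x' : R) : `|x'| < d ->
      U j (refl y) s - (1 - A s + Xs) * U j y s + eps * E * sqn R N (refl y) <=
      U j (refl y + (-1 * x') *: delta_mx 0 i0) s
        - (1 - A s + Xs * expR (- be * x')) * U j (y + x' *: delta_mx 0 i0) s
        + eps * E * sqn R N (refl y + (-1 * x') *: delta_mx 0 i0).
      move=> x'd; apply: (contact_compare _ _ _ _ _ _ _ _ _ _ Zs').
      have := nnU _ (shiftD y x' x'd); rewrite PE refl_shift.
      have -> : k (y + x' *: e1) s = 1 - A s + Xs * expR (- be * x').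
        by rewrite /k /Xs /X coord_e1 -mulrA -expRD; congr (_ + _ * expR _); ring.
      exact.
    have mink (l' : 'I_N) (x' : R) : l' != i0 ->
      U j (refl y) s - (1 - A s + Xs) * U j y s + eps * E * sqn R N (refl y) <=
      U j (refl y + x' *: delta_mx 0 l') s
        - (1 - A s + Xs) * U j (y + x' *: delta_mx 0 l') s
        + eps * E * sqn R N (refl y + x' *: delta_mx 0 l').
      move=> l'i0.
      have yE : (y + x' *: delta_mx 0 l') 0 i0 = y 0 i0.
        by rewrite coord_shift eq_sym (negbTE l'i0) mulr0 addr0.
      have Dz : D0 (y + x' *: delta_mx 0 l') by split; rewrite /= yE.
      have rE : refl (y + x' *: delta_mx 0 l') = refl y + x' *: delta_mx 0 l'.
        by rewrite /refl yE addrAC.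
      apply: (contact_compare _ _ _ _ _ _ _ _ _ _ Zs').
      have := nnU _ Dz; rewrite PE rE.
      have -> : k (y + x' *: delta_mx 0 l') s = 1 - A s + Xs.
        by rewrite /k /Xs /X yE.
      exact.
    have minT s' : t0 <= s' < s -> U j (refl y) s - k y s * U j y s + P y s <=
        U j (refl y) s' - k y s' * U j y s' + P y s'.
      by move=> /past/ltW; rewrite ZE// Zs.
    have ub_le : U j (refl y) s <= kk * U j y s by exact: contact_le Ps Zs.
    have kk_gt0 : 0 < kk by exact: lt_le_trans num1 kk0.
    (* The weak inequality holds at all times, so a contact forces [1 - kk < eta]; the loss in the
       reaction is therefore at most [C * eta * U j y s] plus the penalty. *)
    have keta : 1 - eta < kk.
      by apply: (contact_factor R _ _ _ _ _ Ps ua0 Zs); apply: weak; rewrite y0' y1'.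
    have HF : - C * (eta * U j y s + eps * Q * E) <=
        reaction R m r B j (fun i => U i (refl y) s)
        - kk * reaction R m r B j (fun i => U i y s).
      have k2 : 0 <= kk <= 2 by rewrite ltW.
      have comp i' : 0 <= U i' (refl y) s - kk * U i' y s + P y s.
        by have := nn i' _ Dy; rewrite ZE.
      apply: le_trans (reaction_contact j y (refl y) s kk (P y s) y0' (refl0 _ Dy)
        k2 Ps Zs comp).
      rewrite !mulNr lerN2 ler_wpM2l// lerD2r ler_wpM2r//.
      exact: defect_le (ltW kk_gt0) eta0 keta.
    have [Xk Y8] := ratio_bound R Xs kk (X0 _ _) (X_small y s Dy sI) kk0.
    have Q1 : 1 <= Q by rewrite lerDl sqn_ge0.
    (* The slope bound is used at the image point, which lies between [lam] and [2 * lam]. *)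
    have sl : - K * U j (refl y) s <= dx i0 (U j) (refl y) s.
      by apply: slope; [exact: reflI|exact: reflI2].
    have sg2 : (-1 : R) ^+ 2 = 1 by rewrite sqrrN expr1n.
    have [first main] := contact_inequality hN (U j) y (refl y) t0 s (-1) (1 - A s)
      Xs be (eps * E) d (k y) (P y) _ _ (sol_C21 solU j) d0 dy dr sg2 min0 mink
      dk dP (esym kkE) t0s minT.
    apply: (reflection_no_contact R C K be Xs (Xs / kk) kk (U j y s) (U j (refl y) s)
      (dx i0 (U j) y s) (dx i0 (U j) (refl y) s) eta eps E (refl y 0 i0) Q N%:R _
      C0 be0 Kbe K0 (ltW (X0 _ _)) Xk Y8 ua0 ub_le eps0 (expR_gt0 _)
      (refl0 _ Dy) Q1 (ler0n _ _) sl first HF).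
    move: main; rewrite kkE !equation//; last first.
      exact: lt_trans lam_gt0 (reflI y y1).
have x0 : 0 <= x 0 i0 by case/andP: x0lam.
have Dx : D0 x by case/andP: x0lam.
have := pos i x t1 Dx; rewrite t01 lexx => /(_ isT).
rewrite /Z !ext_id//; last exact: refl0.
have tau1 : tau t1 = T by rewrite /tau; ring.
have -> : k x t1 = 1 + mu * expR (om * T) * (expR (be * (lam - x 0 i0)) - 1).
  by rewrite /k /A /X tau1 subrr mulr0 expRD; move: (expR _) (expR _) => *; ring.
have aux (a b c : R) : 0 < a - b + c -> b <= a + c by lra.
have -> : P x t1 = eps * ((1 + sqn R N (refl x)) * expR (Kp * T)).
  by rewrite /P tau1 mulrA.
exact: aux.
Qed.

Lemma reflection_bound i (x : 'rV[R]_N) t : 0 <= x 0 i0 <= lam ->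
  (1 + mu * expR (om * T) * (expR (be * (lam - x 0 i0)) - 1)) * U i x t <=
  U i (x + (2 * (lam - x 0 i0)) *: e1) t.
Proof.
move=> x0; apply/ler_addgt0Pr => e e0.
set c := (1 + sqn R N (refl x)) * expR ((2 * N%:R + C + 1) * T).
have c0 : 0 <= c by rewrite mulr_ge0 ?expR_ge0// addr_ge0// sqn_ge0.
have ec : 0 < e / (c + 1) by rewrite divr_gt0// ltr_wpDl.
apply: le_trans (reflection_bound_eps i x t _ ec x0) _.
by rewrite lerD2l -/c -mulrA ler_piMr ?(ltW e0)// mulrC ler_pdivrMr; lra.
Qed.

End Reflection.

(** * Moving planes and monotonicity in the first coordinate *)

Lemma slope_bound L i (x : 'rV[R]_N) t : 0 < x 0 i0 -> x 0 i0 <= L ->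
  - ((C + 1) * (1 + L)) * U i x t <= dx i0 (U i) x t.
Proof.
move=> x0 xL; apply: le_trans (dx1_lower_bound i x t x0).
have /andP[u0 _] := U_bound i x t (ltW x0).
have C1 : 0 < C + 1 by rewrite ltr_wpDl.
by rewrite ler_wpM2r// lerN2 ler_wpM2l ?(ltW C1)// lerD2l.
Qed.

(* By the translation bound, moving the mirror by [dl] loses at most a factor
   [1 - 2 K dl], which the reflection bound restores. *)
Lemma moving_plane_step L : 0 < L -> exists2 dl : R, 0 < dl &
  forall lam lam' : R, 0 <= lam -> lam < lam' -> lam' <= L -> lam' <= lam + dl ->
  (forall i (x : 'rV[R]_N) t, 0 <= x 0 i0 <= lam ->
    U i x t <= U i (x + (2 * (lam - x 0 i0)) *: e1) t) ->
  forall i (x : 'rV[R]_N) t, 0 <= x 0 i0 <= lam' ->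
    U i x t <= U i (x + (2 * (lam' - x 0 i0)) *: e1) t.
Proof.
(* Images under mirrors up to [L] stay below [2 * L], whence [K]. In [be], [8 * K] is for the drift,
   [2 * C] for [C <= be ^+ 2 / 2], and 2 for [be >= 1]. *)
move=> L0; pose K := (C + 1) * (1 + 2 * L); pose be := 8 * K + 2 * C + 2.
have C_ge0 := C0.
have K0 : 0 < K by apply: mulr_gt0; lra.
have be2 : 2 <= be by rewrite /be; lra.
have be0 : 0 < be by lra.
have bC : 2 * C <= be ^+ 2.
  have : be * 1 <= be * be by rewrite ler_wpM2l; lra.
  by rewrite -expr2 /be; lra.
have om0 : 0 < be ^+ 2 / 2 by rewrite divr_gt0// exprn_gt0.
(* The same number serves as [eta] and as [mu]; the exponential entry is what [mu_small] asks for,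
   uniformly for mirrors up to [L]. *)
pose eta := Num.min (1 / 2) (expR (- (2 * be * L + 2)) / 16).
have eta0 : 0 < eta.
  by rewrite lt_min; apply/andP; split; [lra|rewrite divr_gt0// expR_gt0].
have eta_half : eta <= 1 / 2 by rewrite ge_min lexx.
exists (eta / (2 * K)); first by rewrite divr_gt0// mulr_gt0.
move=> lam lam' lam_ge0 lamlt lamL lamd mono i x t xlam'.
have lam'0 : 0 < lam' by lra.
(* Chosen so that [om T = be * lam' + 2]; the extra factor [expR 2 >= 4] then absorbs [eta] and the
   term in [C * eta * T] in [mu_init]. *)
pose T := (be * lam' + 2) / (be ^+ 2 / 2).
have z0 : 0 < be * lam' + 2 by rewrite ltr_wpDl// mulr_ge0// ltW.
have T0 : 0 < T by exact: divr_gt0.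
have omT : be ^+ 2 / 2 * T = be * lam' + 2 by rewrite /T mulrC divfK// gt_eqF.
have d2K : 2 * K * (lam' - lam) <= eta.
  have K2 : 0 < 2 * K by exact: mulr_gt0.
  by rewrite mulrC -ler_pdivlMr//; lra.
have shift_le j (y : 'rV[R]_N) h s : 0 <= y 0 i0 -> 0 <= h ->
    y 0 i0 + h <= 2 * L -> h <= 2 * (lam' - lam) ->
    (1 - eta) * U j y s <= U j (y + h *: e1) s.
  move=> y0 h0 yhL hl; apply: le_trans (translation_bound j y h s y0 h0).
  have /andP[u0 _] := U_bound j y s y0; apply: ler_wpM2r => //.
  apply: le_trans (expR_ge1Dx _).
  have q1 : (C + 1) * h * (1 + y 0 i0 + h / 2) <= (C + 1) * h * (1 + 2 * L).
    by apply: ler_wpM2l; [apply: mulr_ge0 => //; lra|lra].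
  have q2 : K * h <= K * (2 * (lam' - lam)) by apply: ler_wpM2l => //; exact: ltW.
  have q3 : K * h = (C + 1) * h * (1 + 2 * L) by rewrite /K; ring.
  lra.
have e4 : 4 <= expR (2 : R).
  have -> : (2 : R) = 1 + 1 by ring.
  have e2 := expR_ge1Dx (1 : R).
  rewrite expRD; have : (2 : R) * 2 <= expR 1 * expR 1 by apply: ler_pM; lra.
  by lra.
have ebl := expR_ge1Dx (be * lam').
have bl0 : 0 <= be * lam' by rewrite mulr_ge0 ?ltW.
have CT : C * T <= be * lam' + 2 by rewrite -omT ler_wpM2r ?(ltW T0)//; lra.
have slope j (y : 'rV[R]_N) s : lam' < y 0 i0 -> y 0 i0 < 2 * lam' ->
    - K * U j y s <= dx i0 (U j) y s.
  by move=> y1 y2; apply: slope_bound; lra.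
have weak j (y : 'rV[R]_N) s : 0 <= y 0 i0 <= lam' ->
    (1 - eta) * U j y s <= U j (y + (2 * (lam' - y 0 i0)) *: e1) s.
  move=> /andP[y0 y1]; have [yl|ly] := leP (y 0 i0) lam.
    have e1eta : 0 <= 1 - eta by lra.
    have := mono j y s; rewrite y0 yl => /(_ isT)/(ler_wpM2l e1eta) le1.
    apply: le_trans le1 _.
    have -> : y + (2 * (lam' - y 0 i0)) *: e1 =
        y + (2 * (lam - y 0 i0)) *: e1 + (2 * (lam' - lam)) *: e1.
      by rewrite -addrA -scalerDl; congr (_ + _ *: _); ring.
    by apply: shift_le; rewrite ?coord_e1; lra.
  by apply: shift_le; lra.
have mu_eta : C * eta <= eta * (be ^+ 2 / 2).
  by rewrite mulrC ler_wpM2l ?(ltW eta0)//; lra.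
have mu_init : eta * expR (be * lam') + eta
    <= eta * expR (be ^+ 2 / 2 * T) - C * eta * T.
  rewrite omT expRD.
  have : expR (be * lam') * 4 <= expR (be * lam') * expR 2.
    by rewrite ler_wpM2l// expR_ge0.
  move=> q; have : eta * (expR (be * lam') + 1 + C * T) <=
      eta * (expR (be * lam') * expR 2) by rewrite ler_wpM2l ?(ltW eta0)//; lra.
  lra.
have mu_small : eta * expR (be ^+ 2 / 2 * T + be * lam') <= 1 / 16.
  have : eta * expR (be ^+ 2 / 2 * T + be * lam') <=
      expR (- (2 * be * L + 2)) / 16 * expR (2 * be * L + 2).
    apply: ler_pM; rewrite ?expR_ge0 ?(ltW eta0)//; first by rewrite ge_min lexx orbT.
    rewrite ler_expR omT; have : be * lam' <= be * L by rewrite ler_wpM2l// ltW.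
    lra.
  by move=> le1; apply: le_trans le1 _; rewrite mulrAC -expRD addNr expR0.
have Kbe : 8 * K <= be by rewrite /be; lra.
have := reflection_bound lam' K eta be eta T lam'0 (ltW K0) (ltW eta0) eta_half be0
  Kbe eta0 T0 slope weak mu_eta mu_init mu_small i x t xlam'.
apply: le_trans.
have /andP[u0 _] : 0 <= U i x t <= M by apply: U_bound; case/andP: xlam'.
rewrite ler_peMl// lerDl mulr_ge0//.
  by rewrite mulr_ge0 ?expR_ge0// ltW.
rewrite subr_ge0 -[X in X <= _]expR0 ler_expR mulr_ge0 ?(ltW be0)// subr_ge0.
by case/andP: xlam'.
Qed.

(** The step length depends on [L] only, so finitely many steps reach every mirror up to [L]. They
    start from the boundary plane, where only [x_1 = 0] is concerned and the reflection fixes the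
    point. *)
Lemma symmetric_monotone L lam i (x : 'rV[R]_N) t : 0 < L -> lam <= L ->
  0 <= x 0 i0 <= lam -> U i x t <= U i (x + (2 * (lam - x 0 i0)) *: e1) t.
Proof.
move=> L0; have [dl dl0 step] := moving_plane_step L L0.
have main n : forall l j (y : 'rV[R]_N) s, l <= L -> l <= n%:R * dl ->
    0 <= y 0 i0 <= l -> U j y s <= U j (y + (2 * (l - y 0 i0)) *: e1) s.
  elim: n => [|n IHn] l j y s lL ln /andP[y0 yl].
    have -> : l - y 0 i0 = 0 by move: ln; rewrite mul0r => ln; lra.
    by rewrite mulr0 scale0r addr0.
  have [ln'|nl] := leP l (n%:R * dl); first by apply: IHn; rewrite ?y0.
  have nd0 : 0 <= n%:R * dl by rewrite mulr_ge0// ltW.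
  apply: (step (n%:R * dl) l) => //; last by rewrite y0.
    by rewrite -[X in _ + X]mul1r -mulrDl -natr1 in ln *.
  by move=> k z t' zl; apply: IHn => //; apply: ltW; exact: lt_le_trans lL.
move=> lamL; have [n Hn] : exists n : nat, L <= n%:R * dl.
  exists (Num.bound (L / dl)); rewrite -ler_pdivrMr//.
  by apply/ltW; apply: archi_boundP; rewrite divr_ge0// ltW.
by apply: (main n) => //; exact: le_trans lamL Hn.
Qed.

(** The two points are mirror images in the plane midway between them. *)
Lemma monotone i (x : 'rV[R]_N) h t : 0 <= x 0 i0 -> 0 <= h ->
  U i x t <= U i (x + h *: e1) t.
Proof.
move=> x0 h0; pose lam := x 0 i0 + h / 2.
have -> : h = 2 * (lam - x 0 i0) by rewrite /lam; field.
by apply: (symmetric_monotone (lam + 1)); rewrite /lam ?x0/=; lra.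
Qed.

(** * Geometric growth away from the boundary *)

Lemma dx1_ge0 i (x : 'rV[R]_N) t : 0 < x 0 i0 -> 0 <= dx i0 (U i) x t.
Proof.
move=> x0; have dU : is_derive (0 : R) 1 (fun h => U i (x + h *: e1) t)
    (dx i0 (U i) x t).
  have := is_derive_line R N ((U i)^~ t) x e1 0.
  by rewrite scale0r addr0; apply; exact: (@C21_ex_dx _ _ _ _ (sol_C21 solU i)).
apply: (derive_ge0_right R _ 0 1 _ ltr01 dU) => h /andP[h0 _].
by rewrite scale0r addr0; apply: monotone; exact: ltW.
Qed.

(** [reflection_bound] with [K = eta = 0] and the mirror at [lam = 2 x_1]. Parabolic scaling,
    [be = 1 / lam] and [T = 2 lam^2], turns all exponents into numbers, and
    [expR (1 / 2) - 1 >= 1 / 2] yields the constant. *)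
Lemma tripling i (x : 'rV[R]_N) t : 0 < x 0 i0 ->
  (1 + expR (-1) / 32) * U i x t <= U i (x + (2 * x 0 i0) *: e1) t.
Proof.
move=> x0; pose lam := 2 * x 0 i0; pose be := lam^-1; pose mu : R := expR (- 2) / 16.
have lam0 : 0 < lam by rewrite mulr_gt0.
have be0 : 0 < be by rewrite invr_gt0.
have om0 : 0 < be ^+ 2 / 2 by rewrite divr_gt0// exprn_gt0.
pose T := (be ^+ 2 / 2)^-1.
have omT : be ^+ 2 / 2 * T = 1 by rewrite divff// gt_eqF.
have bl : be * lam = 1 by rewrite mulVf// gt_eqF.
have mu0 : 0 < mu by rewrite divr_gt0// expR_gt0.
have T0 : 0 < T by rewrite invr_gt0.
have slope j (y : 'rV[R]_N) s : lam < y 0 i0 -> y 0 i0 < 2 * lam ->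
    - 0 * U j y s <= dx i0 (U j) y s.
  by move=> y1 _; rewrite oppr0 mul0r; apply: dx1_ge0; exact: lt_trans y1.
have weak j (y : 'rV[R]_N) s : 0 <= y 0 i0 <= lam ->
    (1 - 0) * U j y s <= U j (y + (2 * (lam - y 0 i0)) *: e1) s.
  by move=> /andP[y0 y1]; rewrite subr0 mul1r; apply: monotone => //; lra.
have mu_eta : C * 0 <= mu * (be ^+ 2 / 2) by rewrite mulr0 mulr_ge0// ltW.
have mu_init : mu * expR (be * lam) + 0 <= mu * expR (be ^+ 2 / 2 * T) - C * 0 * T.
  by rewrite omT bl mulr0 mul0r subr0 addr0.
have mu_small : mu * expR (be ^+ 2 / 2 * T + be * lam) <= 1 / 16.
  have two : - 2 + (1 + 1) = 0 :> R by ring.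
  by rewrite omT bl /mu mulrAC -expRD two expR0.
have half0 : (0 : R) <= 1 / 2 by lra.
have Kbe : 8 * 0 <= be by rewrite mulr0 ltW.
have xlam : 0 <= x 0 i0 <= lam by rewrite /lam; apply/andP; split; lra.
have := reflection_bound lam 0 0 be mu T lam0 (lexx _) (lexx _) half0 be0 Kbe mu0
  T0 slope weak mu_eta mu_init mu_small i x t xlam.
have -> : 2 * (lam - x 0 i0) = 2 * x 0 i0 by rewrite /lam; ring.
apply: le_trans; have /andP[u0 _] := U_bound i x t (ltW x0).
apply: ler_wpM2r => //; rewrite lerD2l.
have -> : be * (lam - x 0 i0) = 1 / 2.
  have -> : lam - x 0 i0 = lam / 2 by rewrite /lam; field.
  by rewrite mulrA bl.
have -> : mu * expR (be ^+ 2 / 2 * T) = expR (-1) / 16.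
  rewrite omT /mu mulrAC -expRD; congr (expR _ / 16); ring.
have e1' : 0 <= expR (-1 : R) / 16 by rewrite divr_ge0// expR_ge0.
have := ler_wpM2l e1' (expR_ge1Dx (1 / 2 : R)).
lra.
Qed.

(** Tripling the distance [n] times at a fixed time multiplies a positive value by at least
    [(1 + c) ^+ n >= 1 + n c], which eventually exceeds [M]. *)
Lemma solution_zero i (x : 'rV[R]_N) t : 0 <= x 0 i0 -> U i x t = 0.
Proof.
rewrite le_eqVlt => /predU1P[/esym|]; first exact: boundary.
pose c : R := expR (-1) / 32; have c0 : 0 < c by rewrite divr_gt0// expR_gt0.
have growth n : forall y : 'rV[R]_N, 0 < y 0 i0 -> (1 + c) ^+ n * U i y t <= M.
  elim: n => [|n IHn] y y0.
    by rewrite expr0 mul1r; have /andP[] := U_bound i y t (ltW y0).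
  rewrite exprSr -mulrA.
  have := tripling i y t y0; rewrite -/c => le1.
  apply: le_trans (IHn (y + (2 * y 0 i0) *: e1) _); last by rewrite coord_e1; lra.
  by apply: ler_wpM2l => //; rewrite exprn_ge0//; lra.
move=> x0; have /andP[u0 _] := U_bound i x t (ltW x0).
apply/eqP; rewrite eq_le u0 andbT leNgt; apply/negP => u_gt0.
have cu : 0 < c * U i x t by exact: mulr_gt0.
pose n := Num.bound (M / (c * U i x t)).
have Mn : M < n%:R * (c * U i x t).
  by rewrite -ltr_pdivrMr//; apply: archi_boundP; rewrite divr_ge0// ltW.
have bern : 1 + n%:R * c <= (1 + c) ^+ n.
  elim: n {Mn} => [|n IHn]; first by rewrite mul0r addr0 expr0.
  rewrite exprS; have nc : 0 <= n%:R * c * c by rewrite !mulr_ge0// ltW.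
  have : (1 + c) * (1 + n%:R * c) <= (1 + c) * (1 + c) ^+ n.
    by apply: ler_wpM2l => //; lra.
  apply: le_trans; rewrite -natr1; move: n%:R nc => k *; lra.
have := le_trans (ler_wpM2r u0 bern) (growth n x x0).
rewrite mulrDl mul1r -mulrA leNgt => /negP; apply.
exact: ltr_wpDl.
Qed.

End Solution.

(** * The Liouville theorem for the system *)

Theorem theorem2p2 (R : realType) (N m : nat) (hN : (1 <= N)%N)
    (hm : (2 <= m)%N) (r p : R) (hr : 1 <= r) (hp : p = 2 * r + 1)
    (hNp : (N <= 3)%N \/ (N = 4%N /\ p < 15 / 4))
    (B : 'M[R]_m) (hBsym : B^T = B)
    (hBoff : forall i j : 'I_m, i != j -> 0 <= B i j)
    (hBdiag : forall i : 'I_m, 0 < B i i) :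
  ~ exists U : 'I_m -> 'rV[R]_N -> R -> R,
      [/\ classical_solution hN r B U, nonnegative hN U,
          bounded_components hN U & nontrivial hN U].
Proof.
move=> [U [solU nnU bdU [i [x [t [xcl]]]]]]; apply.
have bound j : exists b : R, 0 < b /\
    forall (y : 'rV[R]_N) s, half_space_cl hN y -> U j y s <= b.
  have [b b0 Hb] := pinfty_ex_gt0 (bdU j); exists b; split=> // y s ycl.
  have /= := Hb (y, s) (conj ycl I).
  by apply: le_trans; exact: ler_norm.
have [M HM] := choice bound.
(* The sum of the individual bounds is a common bound for all components. *)
pose S := \sum_j M j.
have S0 : 0 <= S by apply: sumr_ge0 => j _; apply: ltW; case: (HM j).
have U_bound j (y : 'rV[R]_N) s : 0 <= y 0 (Ordinal hN) -> 0 <= U j y s <= S.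
  move=> /(half_space_clE hN) ycl; rewrite nnU//=.
  have [_ /(_ y s ycl)] := HM j; move=> /le_trans; apply.
  rewrite /S (bigD1 j)//= lerDl; apply: sumr_ge0 => k _.
  by apply: ltW; case: (HM k).
have B0 j k : 0 <= B j k by have [->|/hBoff//] := eqVneq j k; exact: ltW.
have [C C0 HC] := reaction_compare R m r S B hr S0 B0.
apply: (solution_zero hN r B U S C solU S0 C0 U_bound HC).
exact/half_space_clE.
Qed.
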